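(* Consider the power network model described in the context (linearized power flows), and suppose that each $f_i$ is continuously differentiable and there exist constants $\mu>0$ and $L>0$ such that for all $i\in\mathcal N$ and all $w\in\mathbb R$, $$-L\le \frac{1}{M_i}\frac{d f_i(w)}{dw}\le -\mu .$$ Let $(\theta(t),\omega(t))$ be the solution of the nodal dynamics from an arbitrary initial state $(\theta(0),\omega(0))$ and let $\omega_b(t)$ be the solution of the blended dynamics. Define $$K:=\frac{32\,N M_b\,(1+\frac{L}{\mu})^2}{(\min_{i\in\mathcal N}M_i)\,\mu^2},\qquad c:=\frac{\mu\lambda_2}{4(\lambda_2+4L^2)} .$$ Then: (1) If $C:=\max_{i\in\mathcal N}\sup_{t>0}|\dot\xi_i(t)|/M_i$ is finite, then there exists a positive constant $\alpha$ such that for all $t>0$, $$\max_{i\in\mathcal N}|\omega_i(t)-\omega_b(t)|^2\le \alpha e^{-ct}+K C^2\frac{(\lambda_2+4L^2)^2}{\lambda_2^3}.$$ (2) If $C_{\lim}:=\max_{i\in\mathcal N}\limsup_{t\to\infty}|\dot\xi_i(t)|/M_i$ is finite, then $$\max_{i\in\mathcal N}\limsup_{t\to\infty}|\omega_i(t)-\omega_b(t)|^2\le K C_{\lim}^2\frac{(\lambda_2+4L^2)^2}{\lambda_2^3}.$$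
   Context: Let $(\mathcal N,\mathcal E)$ be a connected undirected graph with node set $\mathcal N=\{1,\dots,N\}$; $\mathcal N_i$ denotes the set of neighbors of node $i$. Each node $i$ has an inertia constant $M_i>0$ and a function $f_i:\mathbb R\to\mathbb R$ with $f_i(0)=0$; each edge $\{i,j\}$ has a weight $B_{ij}=B_{ji}>0$. The disturbances $\xi_i(t)$ are real-valued signals that are continuously differentiable on $(0,\infty)$ and may have a finite jump at $t=0$: $\xi_i(0_-)$ denotes the value before time $0$ and $\xi_i(0_+)=\lim_{t\to0^+}\xi_i(t)$. The nodal (swing) dynamics with linearized power flow are $$\dot\theta_i=\omega_i,\qquad M_i\dot\omega_i=f_i(\omega_i)+\xi_i(t)-\sum_{j\in\mathcal N_i}B_{ij}(\theta_i-\theta_j),\quad i\in\mathcal N.$$ Set $M=\mathrm{diag}(M_1,\dots,M_N)$, $M_b=\frac1N\sum_i M_i$, $f_b(w)=\frac1N\sum_i f_i(w)$, $\xi_b(t)=\frac1N\sum_i\xi_i(t)$. The blended dynamics is the scalar ODE $M_b\dot\omega_b=f_b(\omega_b)+\xi_b(t)$ with $\omega_b(0)=\sum_iM_i\omega_i(0)/\sum_iM_i$. $L_B$ is the weighted Laplacian with $(L_B)_{ij}=-B_{ij}$ for $i\ne j$ adjacent (0 if not adjacent) and $(L_B)_{ii}=\sum_{j\ne i}B_{ij}$; $\lambda_2$ denotes the second-smallest eigenvalue of $M^{-1}L_B$. Statements ''for $t>0$'' start from $t=0_+$. *)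

(* Defs.v *)
From HB Require Import structures.
From mathcomp Require Import all_boot all_order all_algebra.
From mathcomp Require Import all_classical all_reals all_analysis.
Set Implicit Arguments. Unset Strict Implicit. Unset Printing Implicit Defensive.
Import Order.TTheory GRing.Theory Num.Theory.
Import numFieldNormedType.Exports.
Local Open Scope classical_set_scope.
Local Open Scope ring_scope.

Definition laplacian (R : realType) (N : nat) (adj : rel 'I_N)
  (B : 'I_N -> 'I_N -> R) : 'M[R]_N :=
  \matrix_(i, j) (if i == j then \sum_(k | adj i k) B i k
                  else if adj i j then - B i j else 0).

Definition invM_laplacian (R : realType) (N : nat) (M : 'I_N -> R)
  (adj : rel 'I_N) (B : 'I_N -> 'I_N -> R) : 'M[R]_N :=
  \matrix_(i, j) ((M i)^-1 * laplacian adj B i j).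

(* l is the second-smallest eigenvalue (counted with algebraic multiplicity)
   of the real-spectrum matrix A: the characteristic polynomial of A splits
   over R with the nondecreasingly sorted root list s, and l = s_1
   (0-indexed, i.e. the second entry). *)
Definition second_smallest_eigenvalue (R : realType) (N : nat)
  (A : 'M[R]_N) (l : R) : Prop :=
  exists s : seq R, sorted <=%R s /\
    char_poly A = \prod_(x <- s) ('X - x%:P) /\ l = s`_1.

Definition limsup_pinfty (R : realType) (g : R -> R) : \bar R :=
  ereal_inf [set ereal_sup [set (g t)%:E | t in `]T, +oo[] | T in [set: R]].

(* Main.v *)
(** The network is compared with a quasi-equilibrium.  Since the blended dynamics
balances the total power, [g_i = f_i(omega_b) + xi_i - M_i omega_b'] has zero sum,
so [L_B theta* = g] is solvable for every [t].  With [e_i = omega_i - omega_b] and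
[phi = theta - theta*], normalised to be orthogonal to the constants for the inner
product [<x, y> = sum_i M_i x_i y_i], the error obeys
  [e' = - D(t) e - M^-1 L_B phi],  [phi' = e - L_B^+ g']  modulo constants,
where [D(t)] is diagonal with entries in [[mu, L]] by the mean value theorem.  The
energy [|e|^2 / 2 + phi^T L_B phi / 2 + eps <e, phi>] with
[eps = mu lambda2 / (2 (lambda2 + 4 L^2))] then decays at rate [eps / 2] up to a
forcing proportional to [|M^-1 g'|^2].  The forcing is controlled by
[(1 + L / mu)^2 C^2] because [q = omega_b'] obeys a contracting scalar equation, so
that [|q|] is at most [C / mu] up to an exponentially small term.  The graph enters
only through [phi^T L_B phi >= lambda2 |phi|^2] on the orthogonal of the constants,
which comes from the spectral theorem for [M^(-1/2) L_B M^(-1/2)]. *)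

Require Import Defs.
From HB Require Import structures.
From mathcomp Require Import all_boot all_order all_algebra all_fingroup.
From mathcomp Require Import complex spectral sesquilinear.
From mathcomp Require Import all_classical all_reals all_analysis.
From mathcomp Require Import ring lra.
Import Order.TTheory GRing.Theory Num.Theory.
Import numFieldNormedType.Exports.
Local Open Scope classical_set_scope.
Local Open Scope ring_scope.

Set Implicit Arguments.
Unset Strict Implicit.

(** * The spectral gap of a symmetric positive semidefinite matrix *)

Lemma char_poly_similar (F : fieldType) n (P A : 'M[F]_n) :
  P \in unitmx -> char_poly (invmx P *m A *m P) = char_poly A.
Proof.
move=> Pu; rewrite /char_poly /char_poly_mx.
have Pu' : map_mx polyC P \in unitmx by rewrite map_unitmx.
have -> : 'X%:M - map_mx polyC (invmx P *m A *m P) =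
   invmx (map_mx polyC P) *m ('X%:M - map_mx polyC A) *m map_mx polyC P.
  rewrite !map_mxM map_invmx mulmxBr mulmxBl; congr (_ - _).
  by rewrite scalar_mxC -mulmxA mulVmx // mulmx1.
rewrite !det_mulmx mulrAC -det_mulmx mulVmx // det1 mul1r //.
Qed.

Lemma unitary_rowsP (C : numClosedFieldType) n (U : 'M[C]_n) :
  U \is unitarymx -> forall i j, \sum_k U i k * (U j k)^* = (i == j)%:R.
Proof.
move=> /unitarymxP /matrixP H i j; move: (H i j); rewrite !mxE => <-.
by apply: eq_bigr => k _; rewrite !mxE.
Qed.

(** The spectral theorem for normal matrices lives over a closed field, and a real symmetric matrix
    becomes normal over [R[i]]. That the entries of [d] are real is recovered later by comparing
    characteristic polynomials. *)
Lemma symmetric_diag (R : rcfType) n (S : 'M[R]_n) : S^T = S ->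
  exists2 U : 'M[R[i]]_n, U \is unitarymx & exists d : 'rV[R[i]]_n,
     map_mx (real_complex R) S = invmx U *m diag_mx d *m U.
Proof.
move=> Ssym.
have Sn : map_mx (real_complex R) S \is normalmx.
  apply: symmetric_normalmx.
    apply/is_hermitianmxP; rewrite expr0 scale1r map_mx_id //.
    by rewrite map_trmx Ssym.
  by apply/mxOverP => i j; rewrite mxE; apply/complex_realP; exists (S i j).
exists (spectralmx (map_mx (real_complex R) S)); first exact: spectral_unitarymx.
exists (spectral_diag (map_mx (real_complex R) S)).
exact/orthomx_spectralP.
Qed.

(** A root [a] has a row eigenvector [v], for which the form equals [a] times the positive number
    [v *m v^T]. *)
Lemma char_poly_ge0_roots (R : rcfType) n (S : 'M[R]_n) (s : seq R) :
  (forall x : 'cV_n, 0 <= (x^T *m S *m x) 0 0) ->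
  char_poly S = \prod_(x <- s) ('X - x%:P) -> forall a, a \in s -> 0 <= a.
Proof.
move=> Spsd cpS a as_; have : eigenvalue S a.
  by rewrite eigenvalue_root_char cpS root_prod_XsubC.
case/eigenvalueP => v vS vn0; have := Spsd v^T.
rewrite trmxK vS -scalemxAl mxE => h.
have v2 : 0 < (v *m v^T) 0 0.
  have -> : (v *m v^T) 0 0 = \sum_j v 0 j ^+ 2.
    by rewrite mxE; apply: eq_bigr => j _; rewrite mxE expr2.
  rewrite lt_def sumr_ge0 ?andbT; last by move=> j _; exact: sqr_ge0.
  apply: contra vn0 => /eqP/psumr_eq0P v0; apply/eqP/rowP => j.
  by rewrite mxE; apply/eqP; rewrite -sqrf_eq0 v0 // => k _; exact: sqr_ge0.
by rewrite -(pmulr_lge0 _ v2).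
Qed.

(** In a unitary eigenbasis the form is a sum of squared moduli weighted by the roots in [s]. The
    one-dimensional kernel accounts for exactly one zero root, and orthogonality to [y0] removes
    that coordinate, so every remaining weight is at least the second root. *)
Lemma symmetric_spectral_gap (R : rcfType) n (S : 'M[R]_n) (y0 : 'cV[R]_n)
    (s : seq R) :
  S^T = S -> (forall x : 'cV_n, 0 <= (x^T *m S *m x) 0 0) ->
  y0 != 0 -> S *m y0 = 0 -> (forall x : 'cV_n, S *m x = 0 -> exists c, x = c *: y0) ->
  sorted <=%R s -> char_poly S = \prod_(x <- s) ('X - x%:P) -> (1 < n)%N ->
  0 < s`_1 /\ forall x : 'cV_n, (y0^T *m x) 0 0 = 0 ->
    s`_1 * (x^T *m x) 0 0 <= (x^T *m S *m x) 0 0.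
Proof.
move=> Ssym Spsd y0n0 Sy0 kerS s_sorted cpS n_gt1.
have conj_rho (r : R) : (r%:C%C)^* = r%:C%C by exact: conjc_real.
have s_ge0 := char_poly_ge0_roots Spsd cpS.
have size_s : size s = n.
  by have := size_char_poly S; rewrite cpS size_prod_XsubC => -[].
have [U Uu [d Sd]] := symmetric_diag Ssym.
have Uunit := unitarymx_unit Uu.
set rho := real_complex R in Sd *.
(* Both lists are the roots of the same polynomial over [R[i]], and factorization into linear
   factors is unique up to order. *)
have sdP : perm_eq (map rho s) [tuple d 0 i | i < n].
  apply: prod_XsubC_eq; rewrite big_map big_tuple.
  transitivity (map_poly rho (char_poly S)).
    rewrite cpS rmorph_prod /=; apply: eq_bigr => x _.
    by rewrite rmorphB /= map_polyX map_polyC.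
  rewrite map_char_poly Sd char_poly_similar // char_poly_trig ?diag_mx_is_trig //.
  by apply: eq_bigr => i _; rewrite !mxE eqxx mulr1n tnth_mktuple.
have size_t : size (map rho s) == n by rewrite size_map size_s.
have [p dp] : exists p : 'S_n, forall i, d 0 i = rho s`_(p i).
  have /tuple_permP[p /= pE] : perm_eq [tuple d 0 i | i < n] (Tuple size_t).
    by rewrite perm_sym.
  exists p => i; have := congr1 (fun u => nth 0 u i) pE.
  rewrite !nth_mktuple => ->.
  by rewrite (tnth_nth 0) /= (nth_map 0) // size_s.
(* A row of [U] with zero eigenvalue lies in the complex kernel of [S]. Kernels commute with field
   extension, so this row is a complex multiple of the real vector [y0]. *)
have d_ker i : d 0 i = 0 -> exists c : R[i], forall j, U i j = c * rho (y0 j 0).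
  move=> di0.
  have US : row i U *m map_mx rho S = 0.
    rewrite Sd -row_mul !mulmxA mulmxV // mul1mx row_mul row_diag_mx di0 scale0r.
    by rewrite mul0mx.
  have : (row i U <= kermx (map_mx rho S))%MS by apply/sub_kermxP.
  rewrite -map_kermx => /submxP[D UD].
  have : (kermx S <= y0^T)%MS.
    apply/row_subP => k.
    have : row k (kermx S) *m S = 0 by apply/sub_kermxP; exact: row_sub.
    move/(congr1 trmx); rewrite trmx_mul Ssym trmx0 => /kerS[c /(congr1 trmx)].
    by rewrite trmxK => ->; rewrite linearZ /= scalemx_sub.
  move=> /submxP[E kE]; move: UD; rewrite kE map_mxM mulmxA => UD.
  exists ((D *m map_mx rho E) 0 0) => j.
  have -> : U i j = row i U 0 j by rewrite mxE.
  by rewrite UD mxE big_ord1 !mxE.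
(* Two distinct rows of a unitary matrix are orthonormal, hence cannot both be multiples of [y0]. *)
have d_uniq i j : d 0 i = 0 -> d 0 j = 0 -> i = j.
  move=> /d_ker[a Ha] /d_ker[b Hb]; apply/eqP/negPn/negP => ij.
  have := unitary_rowsP Uu i j; have := unitary_rowsP Uu i i.
  have := unitary_rowsP Uu j j.
  rewrite !eqxx (negPf ij) /=.

  have E (c e : R[i]) : \sum_k c * rho (y0 k 0) * (e * rho (y0 k 0))^* =
      c * e^* * \sum_k rho (y0 k 0) ^+ 2.
    rewrite mulr_sumr; apply: eq_bigr => k _.
    by rewrite rmorphM /= conj_rho expr2 mulrACA.
  under eq_bigr do rewrite Hb; rewrite E => H1.
  under eq_bigr do rewrite Ha; rewrite E => H2.
  under eq_bigr do rewrite Ha Hb; rewrite E => H3.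
  move/eqP: H3; rewrite !mulf_eq0 => /orP[/orP[/eqP a0|/eqP b0]|/eqP y2].
  - by move/eqP: H2; rewrite a0 !mul0r eq_sym oner_eq0.
  - by move/eqP: H1; rewrite b0 mulr0 mul0r eq_sym oner_eq0.
  - by move/eqP: H1; rewrite y2 mulr0 eq_sym oner_eq0.
pose i0 := (p^-1)%g (Ordinal (ltnW n_gt1)).
pose i1 := (p^-1)%g (Ordinal n_gt1).
have di0 : d 0 i0 = rho s`_0 by rewrite dp permKV.
have di1 : d 0 i1 = rho s`_1 by rewrite dp permKV.
have i01 : i0 != i1 by rewrite (inj_eq perm_inj).
have le_s j k : (j <= k)%N -> (k < n)%N -> s`_j <= s`_k.
  move=> jk kn; apply: (sorted_leq_nth le_trans lexx) => //.
    by rewrite inE size_s (leq_ltn_trans jk).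
  by rewrite inE size_s.
have s1_gt0 : 0 < s`_1.
  (* If the second root were zero, so would be the first, and [i0], [i1] would contradict
     [d_uniq]. *)
  rewrite lt_def s_ge0 ?mem_nth ?size_s // andbT; apply/eqP => s1.
  have s0 : s`_0 = 0.
    apply/le_anti; rewrite s_ge0 ?mem_nth ?size_s ?(ltnW n_gt1) // andbT.
    by have := le_s 0 1 isT n_gt1; rewrite s1.
  by move/eqP: i01; apply; apply: d_uniq; rewrite ?di0 ?di1 ?s0 ?s1.
have d_ge i : i != i0 -> s`_1 <= s`_(p i).
  move=> ii0; apply: le_s => //.
  rewrite lt0n; apply: contra ii0 => /eqP pi0; apply/eqP/(@perm_inj _ p).
  by rewrite permKV; apply: val_inj.
split=> // x y0x.
(* Coordinates of [v] in the eigenbasis. *)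
pose Z (v : 'cV[R]_n) : 'cV[R[i]]_n := U *m map_mx rho v.
have UtU : map_mx Num.conj U^T *m U = 1%:M.
  by rewrite -invmx_unitary // mulVmx.
have rhoT m k (v : 'M[R]_(m, k)) : map_mx rho v^T = map_mx Num.conj (map_mx rho v)^T.
  by apply/matrixP => a b; rewrite !mxE conj_rho.
have ZD v w : rho ((v^T *m S *m w) 0 0) = \sum_k (Z v k 0)^* * d 0 k * Z w k 0.
  transitivity ((map_mx rho (v^T *m S *m w)) 0 0); first by rewrite [RHS]mxE.
  rewrite !map_mxM Sd invmx_unitary // rhoT !mulmxA.
  have -> : map_mx Num.conj (map_mx rho v)^T *m map_mx Num.conj U^T =
      map_mx Num.conj (Z v)^T.
    by rewrite /Z trmx_mul map_mxM.
  rewrite -mulmxA mxE; apply: eq_bigr => k _.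
  by rewrite mul_mx_diag !mxE.
have Z1 v w : rho ((v^T *m w) 0 0) = \sum_k (Z v k 0)^* * Z w k 0.
  transitivity ((map_mx rho (v^T *m w)) 0 0); first by rewrite [RHS]mxE.
  rewrite !map_mxM rhoT -[map_mx rho w in LHS]mul1mx -UtU !mulmxA.
  have -> : map_mx Num.conj (map_mx rho v)^T *m map_mx Num.conj U^T =
      map_mx Num.conj (Z v)^T.
    by rewrite /Z trmx_mul map_mxM.
  by rewrite -mulmxA mxE; apply: eq_bigr => k _; rewrite !mxE.
have dZ0 k : d 0 k * Z y0 k 0 = 0.
  have : U *m map_mx rho (S *m y0) = 0 by rewrite Sy0 map_mx0 mulmx0.
  rewrite map_mxM Sd !mulmxA mulmxV // mul1mx -mulmxA mul_diag_mx.
  by move/matrixP/(_ k 0); rewrite !mxE.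
(* The eigenvalues at indices other than [i0] are nonzero, so [y0] has only its [i0] coordinate.
   Orthogonality of [x] to [y0] is then the vanishing of a single product, whose factor from [y0] is
   nonzero because [U] is invertible. *)
have Zx0 : Z x i0 0 = 0.
  have Zy k : k != i0 -> Z y0 k 0 = 0.
    move=> ki; have /eqP := dZ0 k; rewrite mulf_eq0 => /orP[|/eqP //].
    rewrite dp fmorph_eq0 => /eqP sp; have := lt_le_trans s1_gt0 (d_ge _ ki).
    by rewrite sp ltxx.
  have := Z1 y0 x; rewrite y0x [rho 0]/(0 : R[i]) (bigD1 i0) //= big1; last first.
    by move=> k ki; rewrite Zy // conjC0 mul0r.
  rewrite addr0 => /esym/eqP; rewrite mulf_eq0 conjC_eq0 => /orP[/eqP Zy0|/eqP //].
  case/negP: y0n0; apply/eqP; have : Z y0 = 0.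
    apply/colP => k; rewrite [RHS]mxE; have [->//|] := eqVneq k i0; exact: Zy.
  move/(congr1 (mulmx (invmx U))); rewrite mulmx0 mulKmx //.
  by move/eqP; rewrite map_mx_eq0 => /eqP.
rewrite -lecR; have -> : (s`_1 * (x^T *m x) 0 0)%:C%C = rho s`_1 * rho ((x^T *m x) 0 0).
  exact: rmorphM.
rewrite -/rho ZD Z1 mulr_sumr; apply: ler_sum => k _.
have [->|/d_ge ki] := eqVneq k i0; first by rewrite Zx0 !mulr0.
rewrite [_^* * d 0 k]mulrC -mulrA dp ler_wpM2r ?lecR //.
by rewrite mulrC mul_conjC_ge0.
Qed.

(** * Weighted graph Laplacians *)

Section Laplacian.
Context {R : realType} {N : nat}.
Variables (adj : rel 'I_N) (B : 'I_N -> 'I_N -> R).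
Hypotheses (adj_sym : forall i j, adj i j = adj j i)
  (adj_irr : forall i, ~~ adj i i)
  (adj_conn : forall i j, connect adj i j)
  (B_sym : forall i j, B i j = B j i)
  (B_pos : forall i j, adj i j -> 0 < B i j).

Definition lap (x : 'I_N -> R) (i : 'I_N) : R :=
  \sum_(j | adj i j) B i j * (x i - x j).

Lemma laplacian_mul x i : \sum_j laplacian adj B i j * x j = lap x i.
Proof.
rewrite (bigD1 i) //= /lap; under [RHS]eq_bigr do rewrite mulrBr.
rewrite big_split /= -mulr_suml sumrN; congr (_ + _).
  by rewrite mxE eqxx.
rewrite -sumrN big_mkcond [RHS]big_mkcond; apply: eq_bigr => j _ /=.
rewrite mxE eq_sym; have [->|ij] := eqVneq j i; first by rewrite (negPf (adj_irr i)).
by case: ifP => _; rewrite ?mul0r // mulNr.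
Qed.

Lemma lapB x y i : lap (fun k => x k - y k) i = lap x i - lap y i.
Proof. by rewrite /lap -sumrB; apply: eq_bigr => j _; ring. Qed.

(** Exchanging [i] and [j] turns the factor [x i] into [- x j]; averaging the two expressions gives
    the edge sum of products of differences. *)
Lemma lap_form x y : \sum_i x i * lap y i =
  2^-1 * \sum_i \sum_(j | adj i j) B i j * (x i - x j) * (y i - y j).
Proof.
have E : \sum_i x i * lap y i =
    \sum_i \sum_(j | adj i j) - (B i j * x j * (y i - y j)).
  under eq_bigr do rewrite /lap mulr_sumr.
  under [RHS]eq_bigr do rewrite big_mkcond.
  rewrite [RHS]exchange_big /=; apply: eq_bigr => i _.
  rewrite big_mkcond; apply: eq_bigr => j _.
  by rewrite adj_sym; case: ifP => // _; rewrite (B_sym i j); ring.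
rewrite [LHS](_ : _ = 2^-1 * (\sum_i x i * lap y i + \sum_i x i * lap y i));
  last by field.
congr (_ * _); rewrite [X in X + _ = _]E -big_split /=; apply: eq_bigr => i _.
rewrite /lap mulr_sumr -big_split /=; apply: eq_bigr => j _; ring.
Qed.

Lemma lap_sym x y : \sum_i x i * lap y i = \sum_i y i * lap x i.
Proof.
by rewrite !lap_form; congr (_ * _); apply: eq_bigr => i _; apply: eq_bigr => j _; ring.
Qed.

Lemma sum_lap x : \sum_i lap x i = 0.
Proof.
have := lap_sym (fun=> 1) x; under eq_bigr do rewrite mul1r; move=> ->.
apply: big1 => i _; rewrite /lap big1 ?mulr0 // => j _; by rewrite subrr mulr0.
Qed.

Lemma lap_form_ge0 x : 0 <= \sum_i x i * lap x i.
Proof.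
rewrite lap_form mulr_ge0 ?invr_ge0 ?ler0n //; apply: sumr_ge0 => i _.
apply: sumr_ge0 => j ij; rewrite -mulrA -expr2.
by rewrite mulr_ge0 ?sqr_ge0 // ltW // B_pos.
Qed.

(** All edge terms are nonnegative, so each vanishes; [x] is then constant along edges and, by
    connectedness, along paths. *)
Lemma lap_form_eq0 x : \sum_i x i * lap x i = 0 -> forall i j, x i = x j.
Proof.
rewrite lap_form => /eqP; rewrite mulf_eq0 invr_eq0 pnatr_eq0 /= => /eqP H.
have T i j : adj i j -> 0 <= B i j * (x i - x j) * (x i - x j).
  by move=> ij; rewrite -mulrA -expr2 mulr_ge0 ?sqr_ge0 // ltW // B_pos.
have step i j : adj i j -> x i = x j.
  move=> ij.
  have /psumr_eq0P Hi : \sum_(j | adj i j) B i j * (x i - x j) * (x i - x j) = 0.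
    by move/psumr_eq0P: H => -> // k _; apply: sumr_ge0 => l; exact: T.
  have /eqP := Hi (fun k => @T i k) _ ij.
  rewrite -mulrA -expr2 mulf_eq0 gt_eqF ?B_pos //= sqrf_eq0 subr_eq0.
  by move/eqP.
move=> i j; have /connectP[p] := adj_conn i j.
elim: p i => [|k p IH] i /=; first by move=> _ ->.
by move=> /andP[/step -> kp] jl; exact: IH.
Qed.

Variable M : 'I_N -> R.
Hypothesis M_pos : forall i, 0 < M i.

(** With [H] the square root of the mass matrix, conjugation by [H] turns [invM_laplacian] into the
    symmetric matrix [S], with the same characteristic polynomial. The kernel of [S] is spanned by
    the vector [h], and under [z i = h i * x i] orthogonality to it becomes the mass-weighted
    mean-zero condition on [x]. *)
Lemma lap_gap l : (1 < N)%N ->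
  second_smallest_eigenvalue (invM_laplacian M adj B) l ->
  0 < l /\ forall x, \sum_i M i * x i = 0 ->
    l * (\sum_i M i * x i ^+ 2) <= \sum_i x i * lap x i.
Proof.
move=> N1 [s [s_sorted [cpA ->]]].
pose h i := Num.sqrt (M i).
have h_gt0 i : 0 < h i by rewrite sqrtr_gt0.
have h_neq0 i : h i != 0 by rewrite gt_eqF.
have hM i : M i = h i ^+ 2 by rewrite sqr_sqrtr // ltW.
pose S : 'M[R]_N := \matrix_(i, j) (laplacian adj B i j / (h i * h j)).
pose H : 'M[R]_N := diag_mx (\row_i h i).
have Hu : H \in unitmx.
  rewrite unitmxE det_diag unitfE; apply/prodf_neq0 => i _; by rewrite mxE.
have SH : invM_laplacian M adj B = invmx H *m S *m H.
  have HA : H *m invM_laplacian M adj B = S *m H.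
    apply/matrixP => i j; rewrite mul_diag_mx mul_mx_diag !mxE hM.
    by field; rewrite !h_neq0.
  by rewrite -mulmxA -HA mulKmx.
have Smul (z : 'cV[R]_N) i : (S *m z) i 0 = lap (fun k => z k 0 / h k) i / h i.
  rewrite mxE -laplacian_mul mulr_suml; apply: eq_bigr => j _.
  by rewrite mxE; field; rewrite !h_neq0.
have Sform (z : 'cV[R]_N) : (z^T *m S *m z) 0 0 =
    \sum_i (z i 0 / h i) * lap (fun k => z k 0 / h k) i.
  rewrite -mulmxA mxE; apply: eq_bigr => i _; rewrite Smul mxE; ring.
have [|x|||x Sx0|||//|s1_gt0 gap] :=
  @symmetric_spectral_gap R N S (\col_i h i) s.
- apply/matrixP => i j; rewrite !mxE [h j * _]mulrC; congr (_ / _).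
  rewrite eq_sym; case: eqP => [->//|_].
  by rewrite adj_sym B_sym.
- by rewrite Sform lap_form_ge0.
- apply/eqP => /colP/(_ (Ordinal N1)); rewrite !mxE => h0.
  by have := h_neq0 (Ordinal N1); rewrite h0 eqxx.
- apply/colP => i; rewrite Smul /lap big1 ?mul0r ?[RHS]mxE // => j _.
  by rewrite !mxE !divff // subrr mulr0.
- have xc : forall i j, x i 0 / h i = x j 0 / h j.
    by apply: lap_form_eq0; rewrite -Sform -mulmxA Sx0 mulmx0 mxE.
  exists (x (Ordinal N1) 0 / h (Ordinal N1)); apply/colP => i.
  by rewrite !mxE -(xc i) divfK.
- exact: s_sorted.
- by rewrite -cpA SH char_poly_similar.
split=> // x xM; have := gap (\col_i (h i * x i)).
have hx i : (\col_i (h i * x i)) i 0 / h i = x i by rewrite mxE mulrC mulKf.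
rewrite Sform; have -> : ((\col_i h i)^T *m \col_i (h i * x i)) 0 0 = \sum_i M i * x i.
  by rewrite mxE; apply: eq_bigr => i _; rewrite !mxE hM expr2 mulrA.
have -> : ((\col_i (h i * x i))^T *m \col_i (h i * x i)) 0 0 = \sum_i M i * x i ^+ 2.
  by rewrite mxE; apply: eq_bigr => i _; rewrite !mxE hM; ring.
move=> /(_ xM) /le_trans; apply; rewrite le_eqVlt; apply/orP; left; apply/eqP.
apply: eq_bigr => i _; rewrite hx; congr (_ * _).
by rewrite /lap; apply: eq_bigr => j _; rewrite !hx.
Qed.

(** The list of roots has length one, so its entry of index 1 is the default value 0. *)
Lemma second_smallest_eigenvalue_single l : N = 1%N ->
  second_smallest_eigenvalue (invM_laplacian M adj B) l -> l = 0.
Proof.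
move=> N1 [s [_ [/(congr1 (fun p : {poly R} => size p)) + ->]]].
by rewrite size_char_poly size_prod_XsubC N1 => -[]; case: s => [|x [|]].
Qed.

Lemma second_smallest_eigenvalue_ge0 l : (0 < N)%N ->
  second_smallest_eigenvalue (invM_laplacian M adj B) l -> 0 <= l.
Proof.
move=> N0 hl; have [N1|N1] := ltnP 1 N; first by apply: ltW; have [] := lap_gap N1 hl.
rewrite (second_smallest_eigenvalue_single _ hl) //.
by apply/eqP; rewrite eqn_leq N1.
Qed.

(** Adding the rank-one matrix with entries [M i * M j] makes the Laplacian invertible. For a
    right-hand side of zero sum, summing the equations forces the weighted mean of the solution to
    vanish, so the added term drops out. The coefficients [G] do not depend on [g], which lets
    solutions be differentiated in time term by term. *)
Lemma lap_inverse : exists G : 'I_N -> 'I_N -> R, forall g : 'I_N -> R,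
  \sum_i g i = 0 ->
  (forall i, lap (fun k => \sum_j G k j * g j) i = g i) /\
  \sum_i M i * (\sum_j G i j * g j) = 0.
Proof.
pose P : 'M[R]_N := \matrix_(i, j) (laplacian adj B i j + M i * M j).
have Pmul (x : 'cV[R]_N) i : (P *m x) i 0 =
    lap (fun k => x k 0) i + M i * \sum_j M j * x j 0.
  rewrite mxE -laplacian_mul mulr_sumr -big_split; apply: eq_bigr => j _.
  by rewrite mxE /=; ring.
have Psol (x : 'cV[R]_N) : \sum_i (P *m x) i 0 = 0 ->
    (forall i, lap (fun k => x k 0) i = (P *m x) i 0) /\ \sum_i M i * x i 0 = 0.
  under eq_bigr do rewrite Pmul; rewrite big_split /= sum_lap add0r -mulr_suml.
  move=> /eqP Hx.
  have Mx0 : \sum_i M i * x i 0 = 0.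
    move: Hx; rewrite mulf_eq0 => /orP[/eqP/psumr_eq0P M0|/eqP //].
    apply: big1 => i _; have := M_pos i; rewrite M0 ?ltxx // => k _; exact: ltW.
  by split=> // i; rewrite Pmul Mx0 mulr0 addr0.
(* A kernel vector satisfies [lap = 0], so it is constant by connectedness; its weighted mean is
   zero, so it vanishes. *)
have Pu : P \in unitmx.
  rewrite -row_free_unit -kermx_eq0; apply/eqP/row_matrixP => i.
  rewrite row0; set v := row i _.
  have vP : P *m v^T = 0.
    have <- : P^T = P.
      apply/matrixP => a b; rewrite !mxE [M b * _]mulrC; congr (_ + _).
      rewrite eq_sym; case: eqP => [->//|_]; by rewrite adj_sym B_sym.
    by rewrite -trmx_mul -row_mul mulmx_ker row0 trmx0.
  have [|lv Mv] := Psol v^T.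
    by rewrite vP; apply: big1 => j _; rewrite mxE.
  have vc : forall a b, v^T a 0 = v^T b 0.
    by apply: lap_form_eq0; apply: big1 => j _; rewrite lv vP [X in _ * X]mxE mulr0.
  apply/rowP => j; rewrite [RHS]mxE.
  move: Mv; under eq_bigr => k _ do rewrite (vc k j).
  rewrite -mulr_suml => /eqP; rewrite mulf_eq0 => /orP[/eqP/psumr_eq0P M0|].
    have := M_pos i; rewrite M0 ?ltxx // => k _; exact: ltW.
  by rewrite mxE => /eqP.
exists (fun i j => invmx P i j) => g g0.
have Pg : P *m (invmx P *m \col_j g j) = \col_j g j by rewrite mulKVmx.
have xE i : (invmx P *m \col_j g j) i 0 = \sum_j invmx P i j * g j.
  by rewrite mxE; apply: eq_bigr => j _; rewrite mxE.
have [|H1 H2] := Psol (invmx P *m \col_j g j).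
  by rewrite Pg -[RHS]g0; apply: eq_bigr => j _; rewrite mxE.
split; last by rewrite -[RHS]H2; apply: eq_bigr => i _; rewrite xE.
move=> i; have := H1 i; rewrite Pg mxE => <-.
by rewrite /lap; apply: eq_bigr => j _; rewrite !xE.
Qed.

End Laplacian.

(** * Derivatives and exponential comparison *)

Section RealDerivatives.
Context {R : realType}.
Implicit Types (f g : R -> R) (t a b : R).

Lemma is_derive_addf f g t a b : is_derive t 1 f a -> is_derive t 1 g b ->
  is_derive t 1 (fun s => f s + g s) (a + b).
Proof. by move=> fa gb; exact: (is_deriveD fa gb). Qed.

Lemma is_derive_subf f g t a b : is_derive t 1 f a -> is_derive t 1 g b ->
  is_derive t 1 (fun s => f s - g s) (a - b).
Proof. by move=> fa gb; exact: (is_deriveB fa gb). Qed.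

Lemma is_derive_mulf f g t a b : is_derive t 1 f a -> is_derive t 1 g b ->
  is_derive t 1 (fun s => f s * g s) (a * g t + f t * b).
Proof.
move=> fa gb; apply: is_derive_eq (is_deriveM fa gb) _.
by rewrite /GRing.scale /=; ring.
Qed.

Lemma is_derive_cmulf f t a b : is_derive t 1 f a ->
  is_derive t 1 (fun s => b * f s) (b * a).
Proof. by move=> fa; exact: (is_deriveZ b fa). Qed.

Lemma is_derive_sumf (I : finType) (P : pred I) (h : I -> R -> R) (dh : I -> R) t :
  (forall i, P i -> is_derive t 1 (h i) (dh i)) ->
  is_derive t 1 (fun s => \sum_(i | P i) h i s) (\sum_(i | P i) dh i).
Proof.
move=> H; have -> : (fun s => \sum_(i | P i) h i s) = \sum_(i | P i) h i.
  by apply/funext => s; rewrite fct_sumE.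
by elim/big_ind2 : _ => // [|*]; [exact: is_derive_cst|exact: is_deriveD].
Qed.

Lemma is_derive_compf f g t a b : is_derive (g t) 1 f a -> is_derive t 1 g b ->
  is_derive t 1 (fun s => f (g s)) (a * b).
Proof.
move=> fa gb; exact: (is_derive1_comp fa gb).
Qed.

Lemma is_derive_expZ t a : is_derive t 1 (fun s => expR (a * s)) (a * expR (a * t)).
Proof.
have aid : is_derive t 1 (fun s => a * s) a.
  by apply: is_derive_eq (is_derive_cmulf a (is_derive_id t 1)) _; rewrite mulr1.
by rewrite mulrC; exact: (is_derive_compf (is_derive_expR (a * t)) aid).
Qed.

Lemma derivable_is_derive1 f t : derivable f t 1 -> is_derive t 1 f (derive1 f t).
Proof. by move=> /derivableP; rewrite derive1E. Qed.

Lemma nonincreasing_from f df (T : R) :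
  (forall t, T <= t -> is_derive t 1 f (df t)) -> (forall t, T <= t -> df t <= 0) ->
  forall t, T <= t -> f t <= f T.
Proof.
move=> fd df0 t Tt.
have fdP x : T <= x -> derivable f x 1 /\ derive1 f x = df x.
  by move=> /fd [fx fxE]; rewrite derive1E.
apply: (@ler0_derive1_le_cc _ f T t) => //; rewrite ?in_itv /= ?lexx ?Tt //.
- by move=> x /itvP xT; have [] := fdP x; rewrite ?xT.
- by move=> x /itvP xT; have [|_ ->] := fdP x; rewrite ?df0 ?xT.
- apply: continuous_in_subspaceT => x; rewrite inE /= in_itv /= => /andP[xT _].
  by apply/differentiable_continuous/derivable1_diffP; have [] := fdP x xT.
Qed.

(** Multiplying by the integrating factor [expR (c * t)] gives a nonincreasing [z]. The correction
    with coefficient [b1 / (nu - c)] absorbs the decaying forcing exactly, and being nonnegative it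
    can be discarded at the end. *)
Lemma gronwall_exp (y dy : R -> R) (T c nu b0 b1 : R) :
  0 < c -> c < nu -> 0 <= b1 ->
  (forall t, T <= t -> is_derive t 1 y (dy t)) ->
  (forall t, T <= t -> dy t + c * y t <= b0 + b1 * expR (- nu * t)) ->
  exists2 A, 0 <= A & forall t, T <= t -> y t <= b0 / c + A * expR (- c * t).
Proof.
move=> c0 cnu b10 yd yle.
pose z t := (y t - b0 / c + b1 / (nu - c) * expR (- nu * t)) * expR (c * t).
pose dz t := (dy t - 0 + b1 / (nu - c) * (- nu * expR (- nu * t))) * expR (c * t)
   + (y t - b0 / c + b1 / (nu - c) * expR (- nu * t)) * (c * expR (c * t)).
have zd t : T <= t -> is_derive t 1 z (dz t).
  move=> Tt; apply: is_derive_mulf; last exact: is_derive_expZ.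
  apply: is_derive_addf; last exact/is_derive_cmulf/is_derive_expZ.
  exact: (is_derive_subf (yd _ Tt) (is_derive_cst _ _ _)).
have dz0 t : T <= t -> dz t <= 0.
  move=> Tt; have -> : dz t =
      (dy t + c * y t - b0 - b1 * expR (- nu * t)) * expR (c * t).
    have nc : nu - c != 0 by rewrite subr_eq0 gt_eqF.
    have c00 : c != 0 by rewrite gt_eqF.
    by rewrite /dz; field; rewrite ?nc ?c00.
  rewrite pmulr_lle0 ?expR_gt0 //; have := yle t Tt; lra.
exists `|z T| => // t Tt.
have := nonincreasing_from zd dz0 Tt; rewrite {1}/z => zt.
have zt' : (y t - b0 / c + b1 / (nu - c) * expR (- nu * t)) <= z T * expR (- c * t).
  have -> : expR (- c * t) = (expR (c * t))^-1 by rewrite mulNr expRN.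
  by rewrite ler_pdivlMr ?expR_gt0.
have p : 0 <= b1 / (nu - c) * expR (- nu * t).
  by rewrite mulr_ge0 ?expR_ge0 // divr_ge0 // subr_ge0 ltW.
have := ler_wpM2r (expR_ge0 (- c * t)) (ler_norm (z T)); lra.
Qed.

End RealDerivatives.

(** * Mass-weighted Young inequality and sign rules *)

Section WeightedSums.
Context {R : realFieldType} {I : finType}.
Variables (M : I -> R).
Hypothesis M_pos : forall i, 0 < M i.

(** The two sides differ by the weighted sum of [(s * u i - v i) ^+ 2], divided by [2 * s]. *)
Lemma weighted_young (u v : I -> R) s : 0 < s ->
  \sum_i M i * u i * v i <=
  s / 2 * \sum_i M i * u i ^+ 2 + (2 * s)^-1 * \sum_i M i * v i ^+ 2.
Proof.
move=> s0; rewrite !mulr_sumr -big_split; apply: ler_sum => i _ /=.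
have -> : s / 2 * (M i * u i ^+ 2) + (2 * s)^-1 * (M i * v i ^+ 2) =
  M i * u i * v i + (2 * s)^-1 * M i * (s * u i - v i) ^+ 2.
  by field; rewrite gt_eqF.
by rewrite lerDl mulr_ge0 ?sqr_ge0 // mulr_ge0 ?(ltW (M_pos i)) // invr_ge0 mulr_ge0 // ltW.
Qed.

Lemma weighted_sqr_ge0 (u : I -> R) : 0 <= \sum_i M i * u i ^+ 2.
Proof. by apply: sumr_ge0 => i _; rewrite mulr_ge0 ?sqr_ge0 // ltW. Qed.

Lemma weighted_sqrN (u : I -> R) :
  \sum_i M i * (- u i) ^+ 2 = \sum_i M i * u i ^+ 2.
Proof. by apply: eq_bigr => i _; rewrite sqrrN. Qed.

Lemma weighted_mulN (u v : I -> R) :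
  \sum_i M i * - u i * v i = - \sum_i M i * u i * v i.
Proof. by rewrite -sumrN; apply: eq_bigr => i _; ring. Qed.

End WeightedSums.

(** * The energy estimate *)

(** Dropping one summand on the left of the defining equation yields the second and third bounds.
    The last one combines [(2 * l + 8 * L ^+ 2) ^+ 2 >= 64 * l * L ^+ 2], an instance of the
    arithmetic-geometric mean inequality, with [mu <= L]. *)
Lemma coupling_bounds (R : realFieldType) (l mu L eps : R) :
  0 < l -> 0 < mu -> mu <= L -> eps * (2 * l + 8 * L ^+ 2) = mu * l ->
  [/\ 0 < eps, eps <= mu / 2, 8 * eps * L ^+ 2 <= mu * l & 64 * eps ^+ 2 <= l].
Proof.
move=> l0 mu0 muL epsE.
have L0 : 0 < L by exact: lt_le_trans muL.
have D0 : 0 < 2 * l + 8 * L ^+ 2.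
  by rewrite addr_gt0 // mulr_gt0 // exprn_gt0.
have eps0 : 0 < eps by rewrite -(pmulr_lgt0 _ D0) epsE mulr_gt0.
have L2 : 0 < L ^+ 2 by rewrite exprn_gt0.
have eL : 0 < eps * L ^+ 2 by rewrite mulr_gt0.
have el : 0 < eps * l by rewrite mulr_gt0.
have eE : 2 * (eps * l) + 8 * (eps * L ^+ 2) = mu * l by rewrite -epsE; ring.
split=> //.
- rewrite -(ler_pM2r l0); lra.
- lra.
- have h : 64 * (l * L ^+ 2) <= (2 * l + 8 * L ^+ 2) ^+ 2.
    rewrite -subr_ge0; have -> : (2 * l + 8 * L ^+ 2) ^+ 2 - 64 * (l * L ^+ 2) =
      (2 * l - 8 * L ^+ 2) ^+ 2 by ring.
    exact: sqr_ge0.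
  have h1 : 64 * eps ^+ 2 * (l * L ^+ 2) <= (mu * l) ^+ 2.
    rewrite -epsE exprMn -mulrA [64 * _]mulrC -mulrA ler_pM2l ?exprn_gt0 //.
    by rewrite mulrC.
  have h2 : (mu * l) ^+ 2 <= l * (l * L ^+ 2).
    rewrite exprMn mulrA -expr2 mulrC ler_pM2l ?exprn_gt0 //.
    by rewrite ler_pXn2r // nnegrE ltW.
  by rewrite -(ler_pM2r (mulr_gt0 l0 L2)); exact: le_trans h1 h2.
Qed.

Section Lyapunov.
Context {R : realType} {N : nat}.
Variables (adj : rel 'I_N) (B : 'I_N -> 'I_N -> R) (M : 'I_N -> R).
Hypotheses (adj_sym : forall i j, adj i j = adj j i)
  (adj_irr : forall i, ~~ adj i i)
  (adj_conn : forall i j, connect adj i j)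
  (B_sym : forall i j, B i j = B j i)
  (B_pos : forall i j, adj i j -> 0 < B i j)
  (M_pos : forall i, 0 < M i).

Variables (l mu L eps : R).
Hypotheses (l0 : 0 < l) (mu0 : 0 < mu) (muL : mu <= L)
  (epsE : eps * (2 * l + 8 * L ^+ 2) = mu * l)
  (gap : forall x, \sum_i M i * x i = 0 ->
    l * (\sum_i M i * x i ^+ 2) <= \sum_i x i * lap adj B x i).

Definition energy (e phi : 'I_N -> R) : R :=
  2^-1 * (\sum_i M i * e i ^+ 2) + 2^-1 * (\sum_i phi i * lap adj B phi i)
  + eps * (\sum_i M i * e i * phi i).

(** The time derivative of [energy] when [e] and [phi] have velocities [de] and [dphi]; symmetry of
    the Laplacian has merged the two halves of the potential term. *)
Definition energy_rate (e de phi dphi : 'I_N -> R) : R :=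
  \sum_i M i * e i * de i + \sum_i dphi i * lap adj B phi i
  + eps * (\sum_i M i * de i * phi i + \sum_i M i * e i * dphi i).

Lemma cross_term (e phi : 'I_N -> R) : \sum_i M i * phi i = 0 ->
  eps * (\sum_i M i * e i * phi i) <=
  16^-1 * ((\sum_i M i * e i ^+ 2) + \sum_i phi i * lap adj B phi i).
Proof.
move=> phi0; have [eps0 _ _ eps2] := coupling_bounds l0 mu0 muL epsE.
(* This weight makes the coefficient of the kinetic sum [1 / 16]; the other coefficient,
   [4 * eps ^+ 2], is at most [l / 16], and the gap converts it into potential energy. *)
have s0 : 0 < 8^-1 / eps by rewrite divr_gt0.
have := ler_wpM2l (ltW eps0) (weighted_young M_pos e phi s0).
have := ler_wpM2r (weighted_sqr_ge0 M_pos phi) eps2; have := gap phi0.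
set a2 := \sum_i M i * e i ^+ 2; set p2 := \sum_i M i * phi i ^+ 2.
have -> : eps * (8^-1 / eps / 2 * a2 + (2 * (8^-1 / eps))^-1 * p2) =
  16^-1 * a2 + 4 * eps ^+ 2 * p2 by field; rewrite gt_eqF.
lra.
Qed.

(** [cross_term] for [- e] bounds the coupling from below, which leaves [1/2 - 1/16 = 7/16] of both
    quadratic parts; the potential one is nonnegative. *)
Lemma energy_ge (e phi : 'I_N -> R) : \sum_i M i * phi i = 0 ->
  7 / 16 * (\sum_i M i * e i ^+ 2) <= energy e phi.
Proof.
move=> phi0; have := cross_term (fun i => - e i) phi0.
rewrite weighted_mulN.
rewrite weighted_sqrN.
have := lap_form_ge0 adj_sym B_sym B_pos phi; rewrite /energy; lra.
Qed.

(** The coupling term supplies the missing dissipation [- eps * b2]. It is spent exactly: [7/32] on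
    [T1], [1/2] on [T2], [9/32] on the energy itself. For [a2], the damping [mu] covers [mu/16],
    [mu/4] and [(1 + 9/32) * eps], since [eps <= mu / 2]. The forcing collects
    [8/7 + 17/28 = 7/4]. *)
Lemma energy_dissipation (e de phi dphi d h : 'I_N -> R) :
  (forall i, mu <= d i <= L) ->
  (forall i, M i * de i = - (M i * d i * e i) - lap adj B phi i) ->
  (forall i, lap adj B dphi i = lap adj B e i - M i * h i) ->
  \sum_i M i * phi i = 0 -> \sum_i M i * dphi i = 0 ->
  energy_rate e de phi dphi + eps / 2 * energy e phi <=
    7 / 4 / (eps * l) * (\sum_i M i * h i ^+ 2).
Proof.
move=> dP deE dphiE phi0 dphi0.
have [eps0 eps_mu epsL eps2] := coupling_bounds l0 mu0 muL epsE.
have h0 : \sum_i M i * h i = 0.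
  have := sum_lap adj_sym B_sym dphi; under eq_bigr do rewrite dphiE.
  rewrite sumrB (sum_lap adj_sym B_sym) sub0r => /eqP.
  by rewrite oppr_eq0 => /eqP.
have [G GP] := lap_inverse adj_sym adj_irr adj_conn B_sym B_pos M_pos.
have [lapx x0] := GP _ h0.
set x := fun k => _ in lapx x0; rewrite -/x in x0.
(* The Laplacian annihilates [e - x - dphi], so on a connected graph this difference is a constant
   [m]. *)
have [m dphi_e] : exists m, forall i, dphi i = e i - m - x i.
  have rc : forall i j, e i - x i - dphi i = e j - x j - dphi j.
    apply: (lap_form_eq0 adj_sym adj_conn B_sym B_pos); apply: big1 => i _.
    by rewrite !lapB lapx dphiE; ring.
  have [|N0] := posnP N.
    by move=> N0; exists 0 => i; have := ltn_ord i; rewrite {2}N0.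
  exists (e (Ordinal N0) - x (Ordinal N0) - dphi (Ordinal N0)) => i.
  by rewrite -(rc i); ring.
set a2 := \sum_i M i * e i ^+ 2; set H2 := \sum_i M i * h i ^+ 2.
set b2 := \sum_i phi i * lap adj B phi i.
set p2 := \sum_i M i * phi i ^+ 2; set x2 := \sum_i M i * x i ^+ 2.
have a20 : 0 <= a2 by exact: weighted_sqr_ge0.
have H20 : 0 <= H2 by exact: weighted_sqr_ge0.
have p20 : 0 <= p2 by exact: weighted_sqr_ge0.
have gp : l * p2 <= b2 by exact: gap.
(* Since [lap x = M h], the gap bounds [l * x2] by the pairing of [x] with [h], and Young with
   weight [l] absorbs half of it. *)
have xH : l ^+ 2 * x2 <= H2.
  have := gap x0; rewrite -/x2.
  under eq_bigr do rewrite lapx mulrCA mulrA.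
  have := weighted_young M_pos x h l0; rewrite -/x2 -/H2.
  have -> : (2 * l)^-1 * H2 = l^-1 * H2 / 2 by field; rewrite gt_eqF.
  move=> u v; have {u v} : l * x2 <= l^-1 * H2 by lra.
  by rewrite [l^-1 * _]mulrC ler_pdivlMr // mulrAC -expr2.
set De := \sum_i M i * d i * e i ^+ 2.
have Dee : mu * a2 <= De.
  rewrite mulr_sumr; apply: ler_sum => i _; rewrite mulrA ler_wpM2r ?sqr_ge0 //.
  by rewrite mulrC ler_wpM2l ?(ltW (M_pos i)) //; have /andP[] := dP i.
set T1 := \sum_i M i * phi i * h i.
(* The exchange between kinetic and potential energy cancels by symmetry of the Laplacian. *)
have E1 : \sum_i M i * e i * de i + \sum_i dphi i * lap adj B phi i = - De - T1.
  rewrite (lap_sym adj_sym B_sym) -sumrN -big_split /= -sumrB.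
  have : \sum_i (phi i * lap adj B e i - e i * lap adj B phi i) = 0.
    by rewrite sumrB (lap_sym adj_sym B_sym) subrr.
  move=> z; rewrite -[RHS]addr0 -[X in _ = _ + X]z -big_split /=.
  apply: eq_bigr => i _; rewrite dphiE.
  by rewrite -mulrA [e i * de i]mulrC mulrA deE; ring.
set T2 := \sum_i M i * phi i * (d i * e i); set T3 := \sum_i M i * e i * x i.
set Se := \sum_i M i * e i.
have E2 : \sum_i M i * de i * phi i = - T2 - b2.
  by rewrite -sumrN -sumrB; apply: eq_bigr => i _; rewrite deE; ring.
have E3 : \sum_i M i * e i * dphi i = a2 - m * Se - T3.
  rewrite mulr_sumr -!sumrB; apply: eq_bigr => i _; rewrite dphi_e; ring.
(* The weighted means of [dphi] and [x] vanish, so [m] is the weighted mean of [e], and the product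
   is [m ^+ 2] times the total mass. *)
have mSe : 0 <= m * Se.
  have SeE : Se = m * \sum_i M i.
    have : \sum_i M i * dphi i = Se - m * \sum_i M i - \sum_i M i * x i.
      by rewrite mulr_sumr -!sumrB; apply: eq_bigr => i _; rewrite dphi_e; ring.
    by rewrite dphi0 x0 subr0 => /esym/eqP; rewrite subr_eq0 => /eqP.
  rewrite SeE mulrA -expr2 mulr_ge0 ?sqr_ge0 //.
  by apply: sumr_ge0 => i _; exact: ltW.
rewrite /energy_rate E1 E2 E3.
have T1b : - T1 <= 7 / 32 * eps * b2 + 8 / 7 / (eps * l) * H2.
  have s0 : 0 < 7 / 16 * (eps * l) by rewrite mulr_gt0 // mulr_gt0.
  have := weighted_young M_pos (fun i => - phi i) h s0.
  rewrite weighted_mulN -/T1.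
  rewrite weighted_sqrN -/p2 -/H2.
  have -> : (2 * (7 / 16 * (eps * l)))^-1 * H2 = 8 / 7 / (eps * l) * H2.
    by field; rewrite !gt_eqF.
  have := ler_wpM2l (ltW eps0) gp; lra.
have T2b : eps * - T2 <= eps * b2 / 2 + mu / 16 * a2.
  have := weighted_young M_pos (fun i => - phi i) (fun i => d i * e i) l0.
  rewrite weighted_mulN -/T2.
  rewrite weighted_sqrN -/p2.
  set d2 := \sum_i _.
  have d2b : d2 <= L ^+ 2 * a2.
    rewrite mulr_sumr; apply: ler_sum => i _; rewrite exprMn mulrCA.
    have /andP[dmu dL] := dP i.
    have Me : 0 <= M i * e i ^+ 2 by rewrite mulr_ge0 ?sqr_ge0 // ltW.
    rewrite ler_wpM2r //.
    have d0 : 0 <= d i by apply: le_trans dmu; exact: ltW.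
 by rewrite ler_pXn2r // nnegrE // (le_trans d0).
  move=> /(ler_wpM2l (ltW eps0)) /le_trans; apply.
  rewrite mulrDr lerD //.
    by have := ler_wpM2l (ltW eps0) gp; lra.
  have -> : eps * ((2 * l)^-1 * d2) = (eps * d2 * 8) / (16 * l).
    by field; rewrite gt_eqF.
  rewrite ler_pdivrMr ?mulr_gt0 //.
  have := ler_wpM2l (ltW eps0) d2b; have := ler_wpM2r a20 epsL; lra.
have T3b : eps * - T3 <= mu / 4 * a2 + eps ^+ 2 / mu * x2.
  have s0 : 0 < mu / (2 * eps) by rewrite divr_gt0 ?mulr_gt0.
  have := weighted_young M_pos (fun i => - e i) x s0.
  rewrite weighted_mulN -/T3.
  rewrite weighted_sqrN -/x2 -/a2.
  move=> /(ler_wpM2l (ltW eps0)).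
  have -> : eps * (mu / (2 * eps) / 2 * a2 + (2 * (mu / (2 * eps)))^-1 * x2) =
     mu / 4 * a2 + eps ^+ 2 / mu * x2 by field; rewrite !gt_eqF.
  by [].
have x2b : eps ^+ 2 / mu * x2 <= 17 / 28 / (eps * l) * H2.
  have -> : eps ^+ 2 / mu * x2 = (eps ^+ 3 / (mu * l)) * (l ^+ 2 * x2) / (eps * l).
    by field; rewrite !gt_eqF.
  rewrite [leRHS]mulrAC ler_pM2r ?invr_gt0 ?mulr_gt0 //.
  (* The constant [17/28] is what [7/4] leaves after [8/7]; the bounds on [eps] actually give
     [1/128]. *)
  have c1 : eps ^+ 3 / (mu * l) <= 17 / 28.
    rewrite ler_pdivrMr ?mulr_gt0 //.
    have : eps * (64 * eps ^+ 2) <= mu / 2 * l.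
      by apply: ler_pM => //; [exact: ltW|rewrite mulr_ge0 ?sqr_ge0].
    have : 0 < mu * l by rewrite mulr_gt0.
    by rewrite [eps ^+ 3]exprS; lra.
  apply: ler_pM => //.
  - by rewrite divr_ge0 ?exprn_ge0 ?mulr_ge0 ?ltW.
  - by rewrite mulr_ge0 ?sqr_ge0 ?weighted_sqr_ge0.
have Wb : energy e phi <= 9 / 16 * (a2 + b2).
  by have := cross_term e phi0; rewrite /energy -/a2 -/b2; lra.
have Wb' : eps / 2 * energy e phi <= 9 / 32 * (eps * a2) + 9 / 32 * (eps * b2).
  have := ler_wpM2l (ltW eps0) Wb; lra.
have := ler_wpM2r a20 eps_mu; have := mulr_ge0 (ltW eps0) mSe.
have : 0 <= mu * a2 by rewrite mulr_ge0 // ltW.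
have -> : 7 / 4 / (eps * l) * H2 = 8 / 7 / (eps * l) * H2 + 17 / 28 / (eps * l) * H2.
  by field; rewrite !gt_eqF.
lra.
Qed.

End Lyapunov.

(** * Error bounds from a positive time on *)

(** The mean value theorem replaces the nonlinear difference by linear damping with a coefficient in
    [[mu, L]]. For [a = b] any slope fits, and [mu] is taken. *)
Lemma mean_slope (R : realType) (f : R -> R) (m mu L : R) : 0 < m -> mu <= L ->
  (forall w, derivable f w 1) ->
  (forall w, - L <= derive1 f w / m <= - mu) ->
  forall a b, exists2 d, mu <= d <= L & f a - f b = - (m * d * (a - b)).
Proof.
move=> m0 muL fd fb.
have lt_case a b : a < b ->
    exists2 d, mu <= d <= L & f b - f a = - (m * d * (b - a)).
  move=> ab; have [||c _ ->] := @MVT R f (derive1 f) a b ab.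
  - by move=> x _; exact: derivable_is_derive1.
  - apply: continuous_subspaceT => x.
    by apply/differentiable_continuous/derivable1_diffP.
  exists (- (derive1 f c / m)); first by have := fb c; lra.
  by field; rewrite gt_eqF.
move=> a b; have [ab|ba|->] := ltgtP a b; last 1 first.
- by exists mu; rewrite ?lexx // !subrr mulr0 oppr0.
- have [d dP fE] := lt_case a b ab; exists d => //.
  by rewrite -[LHS]opprB fE; ring.
- by have [d dP fE] := lt_case b a ba; exists d.
Qed.

(** * Differentiating the energy along curves *)

Section EnergyDerivative.
Context {R : realType} {N : nat}.
Variables (adj : rel 'I_N) (B : 'I_N -> 'I_N -> R) (M : 'I_N -> R) (eps : R).
Hypotheses (adj_sym : forall i j, adj i j = adj j i)
  (B_sym : forall i j, B i j = B j i).

Lemma is_derive_lap (x : 'I_N -> R -> R) (dx : 'I_N -> R) (t : R) i :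
  (forall j, is_derive t 1 (x j) (dx j)) ->
  is_derive t 1 (fun s => lap adj B (fun k => x k s) i) (lap adj B dx i).
Proof.
by move=> xd; apply: is_derive_sumf.
Qed.

Lemma is_derive_energy (e phi : 'I_N -> R -> R) (de dphi : 'I_N -> R) (t : R) :
  (forall i, is_derive t 1 (e i) (de i)) ->
  (forall i, is_derive t 1 (phi i) (dphi i)) ->
  is_derive t 1 (fun s => energy adj B M eps (e^~ s) (phi^~ s))
    (energy_rate adj B M eps (e^~ t) de (phi^~ t) dphi).
Proof.
move=> ed phid.
have e2d i : is_derive t 1 (fun s => M i * e i s ^+ 2) (2 * (M i * e i t * de i)).
  apply: is_derive_eq (is_derive_cmulf (M i) (is_derive_mulf (ed i) (ed i))) _.
  by ring.
have pd i : is_derive t 1 (fun s => phi i s * lap adj B (phi^~ s) i)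
    (dphi i * lap adj B (phi^~ t) i + phi i t * lap adj B dphi i).
  by apply: is_derive_mulf (phid i) _; exact: is_derive_lap.
have epd i : is_derive t 1 (fun s => M i * e i s * phi i s)
    (M i * de i * phi i t + M i * e i t * dphi i).
  by apply: is_derive_mulf (phid i); exact: is_derive_cmulf.
have P0 (g : 'I_N -> R -> R) (dg : 'I_N -> R) :
    (forall i, is_derive t 1 (g i) (dg i)) ->
    is_derive t 1 (fun s => \sum_i g i s) (\sum_i dg i).
  by move=> gd; apply: is_derive_sumf.
apply: is_derive_eq (is_derive_addf (is_derive_addf
  (is_derive_cmulf 2^-1 (P0 _ _ e2d)) (is_derive_cmulf 2^-1 (P0 _ _ pd)))
  (is_derive_cmulf eps (P0 _ _ epd))) _.
rewrite /energy_rate !big_split /=; congr (_ + _ + _).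
  by rewrite -mulr_sumr; field.
by rewrite (lap_sym adj_sym B_sym (phi^~ t)); field.
Qed.

End EnergyDerivative.

(** * Blended dynamics, forcing and error along the trajectories *)

Section Tail.
Context {R : realType} {N : nat}.
Variables (adj : rel 'I_N) (B : 'I_N -> 'I_N -> R) (M : 'I_N -> R)
  (f xi theta omega : 'I_N -> R -> R) (omega_b : R -> R) (mu L : R).
Hypotheses (N_gt0 : (0 < N)%N)
  (adj_sym : forall i j, adj i j = adj j i)
  (adj_irr : forall i, ~~ adj i i)
  (adj_conn : forall i j, connect adj i j)
  (B_sym : forall i j, B i j = B j i)
  (B_pos : forall i j, adj i j -> 0 < B i j)
  (M_pos : forall i, 0 < M i)
  (f_der : forall i w, derivable (f i) w 1)
  (mu_pos : 0 < mu)
  (f_bnd : forall i w, - L <= derive1 (f i) w / M i <= - mu)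
  (xi_der : forall i (t : R), 0 < t -> derivable (xi i) t 1)
  (theta_ode : forall i (t : R), 0 < t ->
     derivable (theta i) t 1 /\ derive1 (theta i) t = omega i t)
  (omega_ode : forall i (t : R), 0 < t -> derivable (omega i) t 1 /\
     M i * derive1 (omega i) t =
       f i (omega i t) + xi i t - lap adj B (theta^~ t) i)
  (omegab_ode : forall t : R, 0 < t -> derivable omega_b t 1 /\
     (\sum_i M i) / N%:R * derive1 omega_b t =
       (\sum_i f i (omega_b t)) / N%:R + (\sum_i xi i t) / N%:R).
Variables (T C : R).
Hypotheses (T_gt0 : 0 < T)
  (xi_bnd : forall i (t : R), T <= t -> `|derive1 (xi i) t| / M i <= C).

Lemma damping_bounds : mu <= L.
Proof. by have := f_bnd (Ordinal N_gt0) 0; lra. Qed.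

Let L_pos : 0 < L := lt_le_trans mu_pos damping_bounds.

Lemma total_mass_gt0 : 0 < \sum_i M i.
Proof.
rewrite (bigD1 (Ordinal N_gt0)) //= ltr_wpDr // sumr_ge0 // => i _; exact: ltW.
Qed.

Let Mt := \sum_i M i.
Let Mt_gt0 : 0 < Mt := total_mass_gt0.
Let T_le t : T <= t -> 0 < t := lt_le_trans T_gt0.

(** [omega_b'] as given by the ODE, in a form that can be differentiated again. *)
Definition blended_rate t := (\sum_i f i (omega_b t) + \sum_i xi i t) / Mt.
Definition blended_accel t :=
  (\sum_i (derive1 (f i) (omega_b t) * blended_rate t + derive1 (xi i) t)) / Mt.

Lemma is_derive_omega_b (t : R) : 0 < t -> is_derive t 1 omega_b (blended_rate t).
Proof.
move=> t0; have [bd bE] := omegab_ode t0.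
apply: is_derive_eq (derivable_is_derive1 bd) _.
have N0 : N%:R != 0 :> R by rewrite pnatr_eq0 -lt0n.
move: bE; rewrite -mulrDl mulrAC => /(mulIf (invr_neq0 N0)) bE.
by rewrite /blended_rate -bE mulrC mulKf ?gt_eqF.
Qed.

Lemma is_derive_blended_rate (t : R) : 0 < t ->
  is_derive t 1 blended_rate (blended_accel t).
Proof.
move=> t0; rewrite /blended_accel big_split mulrC.
have E : (fun s => Mt^-1 * (\sum_i f i (omega_b s) + \sum_i xi i s)) = blended_rate.
  by apply/funext => s; rewrite mulrC.
set a := Mt^-1 * _; suff : is_derive t 1
  (fun s => Mt^-1 * (\sum_i f i (omega_b s) + \sum_i xi i s)) a by rewrite E.
apply/is_derive_cmulf/is_derive_addf.
  apply: is_derive_sumf => i _.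
  have fd := derivable_is_derive1 (@f_der i (omega_b t)).
  exact: is_derive_compf fd (is_derive_omega_b t0).
by apply: is_derive_sumf => i _; exact/derivable_is_derive1/xi_der.
Qed.

Let C_ge0 : 0 <= C.
Proof.
apply: le_trans (xi_bnd (Ordinal N_gt0) (lexx T)).
by rewrite divr_ge0 // ltW.
Qed.

(** Writing [q] for the rate, the slope bound on [f] and the bound on the derivatives of [xi] give
    [q * q' <= - mu * q ^+ 2 + C * |q|]. Young then leaves
    [(q ^+ 2)' + mu * q ^+ 2 <= C ^+ 2 / mu]. *)
Lemma blended_rate_bound : exists2 Q, 0 <= Q & forall t : R, T <= t ->
  blended_rate t ^+ 2 <= (C / mu) ^+ 2 + Q * expR (- mu * t).
Proof.
(* The forcing is constant, so [b1 = 0] and [mu + 1] is merely some exponent above [mu]. *)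
have [|t Tt|t Tt|Q Q0 Qb] := @gronwall_exp R (fun t => blended_rate t ^+ 2)
  (fun t => 2 * (blended_rate t * blended_accel t)) T mu (mu + 1)
  (C ^+ 2 / mu) 0 mu_pos _ (lexx 0).
- by rewrite ltrDl.
- have qd := is_derive_blended_rate (T_le Tt).
  by apply: is_derive_eq (is_derive_mulf qd qd) _; ring.
- rewrite mul0r addr0; set q := blended_rate t.
  have : q * blended_accel t <= - (mu / 2) * q ^+ 2 + C ^+ 2 / (2 * mu).
    rewrite mulrA ler_pdivrMr // mulr_sumr /Mt mulr_sumr.
    apply: ler_sum => i _.
    have /andP[_] := f_bnd i (omega_b t); rewrite ler_pdivrMr // => fi.
    have := xi_bnd i Tt; rewrite ler_pdivrMr // ler_norml => /andP[xi1 xi2].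
    have f1 := ler_wpM2l (sqr_ge0 q) fi.
    have f2 : q * derive1 (xi i) t <= `|q| * (C * M i).
      by rewrite (le_trans (ler_norm _)) // normrM ler_wpM2l // ler_norml xi1.
    have f3 : `|q| * C <= mu / 2 * q ^+ 2 + C ^+ 2 / (2 * mu).
      have -> : mu / 2 * q ^+ 2 + C ^+ 2 / (2 * mu) =
          `|q| * C + (mu * `|q| - C) ^+ 2 / (2 * mu).
        by rewrite -[q ^+ 2]real_normK ?num_real //; field; rewrite gt_eqF.
      by rewrite lerDl divr_ge0 ?sqr_ge0 // mulr_ge0 // ltW.
    have := ler_wpM2r (ltW (M_pos i)) f3; rewrite -/q; lra.
  have -> : C ^+ 2 / (2 * mu) = C ^+ 2 / mu / 2 by field; rewrite gt_eqF.
  lra.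
exists Q => // t Tt; have := Qb t Tt.
by have -> : C ^+ 2 / mu / mu = (C / mu) ^+ 2 by field; rewrite gt_eqF.
Qed.

(** The vector [g] of the header. *)
Definition imbalance i t := f i (omega_b t) + xi i t - M i * blended_rate t.
Definition imbalance_rate i t :=
  derive1 (f i) (omega_b t) * blended_rate t + derive1 (xi i) t - M i * blended_accel t.

Lemma sum_imbalance (t : R) : \sum_i imbalance i t = 0.
Proof.
rewrite sumrB -mulr_suml /blended_rate mulrC divfK ?gt_eqF //.
by rewrite big_split /= subrr.
Qed.

Lemma sum_imbalance_rate (t : R) : \sum_i imbalance_rate i t = 0.
Proof.
by rewrite sumrB -mulr_suml /blended_accel mulrC divfK ?gt_eqF // subrr.
Qed.

Lemma is_derive_imbalance i (t : R) : 0 < t ->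
  is_derive t 1 (imbalance i) (imbalance_rate i t).
Proof.
move=> t0; apply: is_derive_subf.
  apply: is_derive_addf; last exact/derivable_is_derive1/xi_der.
  have fd := derivable_is_derive1 (@f_der i (omega_b t)).
  exact: is_derive_compf fd (is_derive_omega_b t0).
exact/is_derive_cmulf/is_derive_blended_rate.
Qed.

(** Divided by the masses, the imbalance rate is [k i - p] with [p] the weighted mean of [k], and
    removing the mean only decreases the weighted sum of squares. Each [k i] is [a * q + z] with
    [|a| <= L] and [|z| <= C], and [q] is controlled by [blended_rate_bound]. *)
Lemma imbalance_rate_bound : exists2 Q, 0 <= Q & forall t : R, T <= t ->
  \sum_i M i * (imbalance_rate i t / M i) ^+ 2 <=
    Mt * ((1 + L / mu) ^+ 2 * C ^+ 2) + Q * expR (- mu * t).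
Proof.
have [Q Q0 Qb] := blended_rate_bound.
have r0 : 0 < 1 + L / mu by rewrite addr_gt0 // divr_gt0.
exists (Mt * ((1 + L / mu) * (L * mu) * Q)).
  by rewrite mulr_ge0 ?(ltW Mt_gt0) // mulr_ge0 // mulr_ge0 ?ltW // mulr_gt0.
move=> t Tt; set q := blended_rate t; set p := blended_accel t.
pose k i := (derive1 (f i) (omega_b t) * q + derive1 (xi i) t) / M i.
have kE i : imbalance_rate i t / M i = k i - p.
  by rewrite /imbalance_rate /k -/q -/p; field; rewrite gt_eqF.
have sk : \sum_i M i * k i = Mt * p.
  rewrite /p /blended_accel mulrC divfK ?gt_eqF //; apply: eq_bigr => i _.
  by rewrite /k mulrC divfK ?gt_eqF.
have -> : \sum_i M i * (imbalance_rate i t / M i) ^+ 2 =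
    \sum_i M i * k i ^+ 2 - Mt * p ^+ 2.
  transitivity (\sum_i (M i * k i ^+ 2 - 2 * p * (M i * k i) + M i * p ^+ 2)).
    by apply: eq_bigr => i _; rewrite kE; ring.
  by rewrite big_split sumrB -mulr_sumr -mulr_suml sk /= -/Mt; ring.
apply: (@le_trans _ _ (\sum_i M i * k i ^+ 2)).
  by rewrite gerBl mulr_ge0 ?sqr_ge0 // ltW.
rewrite -[Mt * _ * expR _]mulrA -mulrDr /Mt mulr_suml; apply: ler_sum => i _.
rewrite ler_wpM2l ?(ltW (M_pos i)) //.
set a := derive1 (f i) (omega_b t) / M i; set z := derive1 (xi i) t / M i.
have -> : k i = a * q + z by rewrite /k /a /z; field; rewrite gt_eqF.
have a2 : a ^+ 2 <= L ^+ 2.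
  have /andP[a1 a2] := f_bnd i (omega_b t).
  rewrite -[a ^+ 2]real_normK ?num_real // ler_pXn2r ?nnegrE ?(ltW L_pos) //.
  by rewrite ler_norml a1 /=; move: a2; rewrite -/a; have := mu_pos; have := L_pos; lra.
have z2 : z ^+ 2 <= C ^+ 2.
  rewrite -[z ^+ 2]real_normK ?num_real // ler_pXn2r ?nnegrE //.
  by rewrite normrM [`|(M i)^-1|]gtr0_norm ?invr_gt0 // xi_bnd.
have q2 := Qb t Tt; rewrite -/q in q2.
have i0 : 0 <= 1 + mu / L by rewrite addr_ge0 // divr_ge0 // ltW.
(* These Young weights make the two contributions add up to exactly [(1 + L / mu) ^+ 2 * C ^+ 2]
   when [q ^+ 2] is replaced by [(C / mu) ^+ 2]. *)
have s1 : (a * q + z) ^+ 2 <= (1 + mu / L) * (a * q) ^+ 2 + (1 + L / mu) * z ^+ 2.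
  rewrite -subr_ge0; have -> : (1 + mu / L) * (a * q) ^+ 2 + (1 + L / mu) * z ^+ 2
     - (a * q + z) ^+ 2 = (mu * (a * q) - L * z) ^+ 2 / (L * mu).
    by field; rewrite !gt_eqF.
  by rewrite divr_ge0 ?sqr_ge0 // mulr_ge0 // ltW.
apply: le_trans s1 _.
have s2 : (1 + mu / L) * (a * q) ^+ 2 <= (1 + L / mu) * (L * mu * q ^+ 2).
  have -> : (1 + L / mu) * (L * mu * q ^+ 2) = (1 + mu / L) * (L ^+ 2 * q ^+ 2).
    by field; rewrite !gt_eqF.
  by rewrite ler_wpM2l // exprMn ler_wpM2r // sqr_ge0.
have s3 := ler_wpM2l (ltW r0) z2.
have s4 : (1 + L / mu) * (L * mu * q ^+ 2) <=
    (1 + L / mu) * (L * mu * ((C / mu) ^+ 2 + Q * expR (- mu * t))).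
  by rewrite !ler_pM2l // mulr_gt0.
apply: le_trans (lerD (le_trans s2 s4) s3) _.
rewrite le_eqVlt; apply/orP; left; apply/eqP.
by field; rewrite gt_eqF.
Qed.

Let err i t := omega i t - omega_b t.

Lemma is_derive_err i (t : R) : 0 < t ->
  is_derive t 1 (err i) (derive1 (omega i) t - blended_rate t).
Proof.
move=> t0; apply: is_derive_subf (is_derive_omega_b t0).
by apply: derivable_is_derive1; have [] := omega_ode i t0.
Qed.

(** With one node the coupling vanishes and both frequencies solve the same scalar equation, so
    their difference contracts by [mean_slope]. *)
Lemma single_node_decay : N = 1%N -> exists2 A, 0 <= A & forall t : R, T <= t ->
  forall i, err i t ^+ 2 <= A * expR (- mu * t).
Proof.
move=> N1; pose i0 := Ordinal N_gt0.
have all0 i : i = i0.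
  by apply: ord_inj; have := ltn_ord i; rewrite {2}N1 /=; case: (i : nat).
have sumI (g : 'I_N -> R) : \sum_i g i = g i0.
  by rewrite (bigD1 i0) //= big1 ?addr0 // => i; rewrite (all0 i) eqxx.
have [|t Tt|t Tt|A A0 Ab] := @gronwall_exp R (fun t => err i0 t ^+ 2)
   (fun t => 2 * (err i0 t * (derive1 (omega i0) t - blended_rate t))) T mu (mu + 1)
   0 0 mu_pos _ (lexx 0).
- by rewrite ltrDl.
- have ed := is_derive_err i0 (T_le Tt).
  by apply: is_derive_eq (is_derive_mulf ed ed) _; ring.
- have [_ oE] := omega_ode i0 (T_le Tt).
  have [d /andP[dmu _] dE] := mean_slope (M_pos i0) damping_bounds (@f_der i0)
    (f_bnd i0) (omega i0 t) (omega_b t).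
  have lap0 : lap adj B (theta^~ t) i0 = 0.
    by apply: big1 => j _; rewrite (all0 j) subrr mulr0.
  have -> : derive1 (omega i0) t - blended_rate t = - d * err i0 t.
    apply: (mulfI (lt0r_neq0 (M_pos i0))).
    rewrite mulrBr oE lap0 /blended_rate /Mt !sumI [M i0 * (_ / _)]mulrC divfK ?gt_eqF //.
    by rewrite /err; lra.
  have := ler_wpM2r (sqr_ge0 (err i0 t)) dmu.
  have := mulr_ge0 (ltW mu_pos) (sqr_ge0 (err i0 t)).
  lra.
exists A => // t Tt i; rewrite (all0 i).
by have := Ab t Tt; rewrite mul0r add0r.
Qed.

Lemma tail_bound l eps Mm : 0 < l -> eps * (2 * l + 8 * L ^+ 2) = mu * l ->
  (forall x, \sum_i M i * x i = 0 ->
    l * (\sum_i M i * x i ^+ 2) <= \sum_i x i * lap adj B x i) ->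
  0 < Mm -> (forall i, Mm <= M i) ->
  exists2 A, 0 <= A & forall t : R, T <= t -> forall i,
    err i t ^+ 2 <= A * expR (- (eps / 2) * t) +
      8 * Mt * (1 + L / mu) ^+ 2 / (Mm * (eps ^+ 2 * l)) * C ^+ 2.
Proof.
move=> l0 epsE gap Mm0 MmM.
have [eps0 eps_mu _ _] := coupling_bounds l0 mu_pos damping_bounds epsE.
have [G GP] := lap_inverse adj_sym adj_irr adj_conn B_sym B_pos M_pos.
(* Here [lap phi = lap theta - g]: this is [theta] minus the quasi-equilibrium, normalised to
   weighted mean zero. *)
pose phi i t := \sum_j G i j * (lap adj B (theta^~ t) j - imbalance j t).
pose dphi t i := \sum_j G i j * (lap adj B (omega^~ t) j - imbalance_rate j t).
have sum0 t : \sum_j (lap adj B (theta^~ t) j - imbalance j t) = 0.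
  by rewrite sumrB (sum_lap adj_sym B_sym) sum_imbalance subrr.
have dsum0 t : \sum_j (lap adj B (omega^~ t) j - imbalance_rate j t) = 0.
  by rewrite sumrB (sum_lap adj_sym B_sym) sum_imbalance_rate subrr.
have phid i (t : R) : 0 < t -> is_derive t 1 (phi i) (dphi t i).
  move=> t0; apply: is_derive_sumf => j _; apply/is_derive_cmulf/is_derive_subf.
    apply: is_derive_lap => k; have [td <-] := theta_ode k t0.
    exact: derivable_is_derive1.
  exact: is_derive_imbalance.
pose de t i := derive1 (omega i) t - blended_rate t.
have deE (t : R) i : 0 < t -> exists2 d, mu <= d <= L &
    M i * de t i = - (M i * d * err i t) - lap adj B (phi^~ t) i.
  move=> t0; have [d dP dE] := mean_slope (M_pos i) damping_bounds (@f_der i)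
    (f_bnd i) (omega i t) (omega_b t).
  exists d => //; have [_ oE] := omega_ode i t0.
  have [-> _] := GP _ (sum0 t).
  rewrite /de mulrBr oE -opprB /imbalance; move: dE; rewrite -/(err i t); lra.
have [Q Q0 Qb] := imbalance_rate_bound.
pose kap := 7 / 4 / (eps * l).
have kap0 : 0 < kap by rewrite divr_gt0 // mulr_gt0.
(* The transient part of the forcing decays at rate [mu], which exceeds the energy rate [eps / 2]
   because [eps <= mu / 2]. *)
have [|||t Tt|t Tt|A A0 Ab] := @gronwall_exp R
  (fun t => energy adj B M eps (err^~ t) (phi^~ t))
  (fun t => energy_rate adj B M eps (err^~ t) (de t) (phi^~ t) (dphi t))
  T (eps / 2) mu (kap * (Mt * ((1 + L / mu) ^+ 2 * C ^+ 2))) (kap * Q).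
- by rewrite divr_gt0.
- lra.
- by rewrite mulr_ge0 // ltW.
- apply: is_derive_energy => // i; [exact/is_derive_err/T_le|exact/phid/T_le].
- have /choice[d dP] : forall i, exists di, mu <= di <= L /\
      M i * de t i = - (M i * di * err i t) - lap adj B (phi^~ t) i.
    by move=> i; have [di ? ?] := deE t i (T_le Tt); exists di.
  rewrite -[kap * Q * _]mulrA -mulrDr; apply: le_trans (ler_wpM2l (ltW kap0) (Qb t Tt)).
  apply: (energy_dissipation adj_sym adj_irr adj_conn B_sym B_pos M_pos
    l0 mu_pos damping_bounds epsE gap (d := d)).
  + by move=> i; have [] := dP i.
  + by move=> i; have [] := dP i.
  + move=> i; have [-> _] := GP _ (dsum0 t).
    rewrite [M i * _]mulrC divfK ?gt_eqF //; congr (_ - _).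
    by apply: eq_bigr => j _; rewrite /err; ring.
  + by have [] := GP _ (sum0 t).
  + by have [] := GP _ (dsum0 t).
(* The factor [16 / 7] inverts the constant of [energy_ge]; with [7 / 4] from the dissipation and
   [2 / eps] from the rate it produces the constant 8. *)
exists (16 / 7 * A / Mm); first by rewrite divr_ge0 ?mulr_ge0 // ltW.
move=> t Tt i.
have phi0 : \sum_i M i * phi i t = 0 by have [] := GP _ (sum0 t).
have := energy_ge adj_sym B_sym B_pos M_pos l0 mu_pos damping_bounds epsE gap
  (err^~ t) phi0.
have : Mm * err i t ^+ 2 <= \sum_i M i * err i t ^+ 2.
  apply: (@le_trans _ _ (M i * err i t ^+ 2)).
    by rewrite ler_wpM2r ?sqr_ge0.
  rewrite (bigD1 i) //= lerDl sumr_ge0 // => j _.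
  by rewrite mulr_ge0 ?sqr_ge0 // ltW.
have := Ab t Tt => {Ab} W_le e_le W_ge.
rewrite -(ler_pM2l Mm0).
have -> : Mm * (16 / 7 * A / Mm * expR (- (eps / 2) * t) +
   8 * Mt * (1 + L / mu) ^+ 2 / (Mm * (eps ^+ 2 * l)) * C ^+ 2) =
   16 / 7 * (kap * (Mt * ((1 + L / mu) ^+ 2 * C ^+ 2)) / (eps / 2) +
     A * expR (- (eps / 2) * t)).
  by rewrite /kap; field; rewrite !gt_eqF.
lra.
Qed.

(** For a single node [l = 0], so the exponent [mu * l / _] and, because [x / 0 = 0],
    the constant term of the bound both vanish. *)
Lemma tail_error l Mm :
  second_smallest_eigenvalue (invM_laplacian M adj B) l ->
  0 < Mm -> (forall i, Mm <= M i) ->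
  exists A r, [/\ 0 <= A, 0 < r, mu * l / (4 * (l + 4 * L ^+ 2)) <= r &
    forall t : R, T <= t -> forall i, err i t ^+ 2 <= A * expR (- (r * t)) +
      32 * Mt * (1 + L / mu) ^+ 2 / (Mm * mu ^+ 2) * C ^+ 2 *
        ((l + 4 * L ^+ 2) ^+ 2 / l ^+ 3)].
Proof.
move=> hl Mm0 MmM.
have [N1|N_le1] := ltnP 1 N.
- have [l0 gap] := lap_gap adj_sym adj_irr adj_conn B_sym B_pos M_pos N1 hl.
  have D0 : 0 < l + 4 * L ^+ 2 by rewrite addr_gt0 // mulr_gt0 // exprn_gt0.
  have L2 : 0 < L ^+ 2 by rewrite exprn_gt0.
  pose eps := mu * l / (2 * (l + 4 * L ^+ 2)).
  have epsE : eps * (2 * l + 8 * L ^+ 2) = mu * l.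
    by rewrite /eps; field; rewrite gt_eqF.
  have [A A0 Ab] := tail_bound l0 epsE gap Mm0 MmM.
  have cE : mu * l / (4 * (l + 4 * L ^+ 2)) = eps / 2.
    by rewrite /eps; field; rewrite gt_eqF.
  exists A, (eps / 2); split; rewrite ?cE //.
    by rewrite divr_gt0 // /eps divr_gt0 ?mulr_gt0.
  move=> t Tt i; have := Ab t Tt i; rewrite mulNr => /le_trans; apply.
  rewrite le_eqVlt; apply/orP; left; apply/eqP; congr (_ + _).
  (* Substituting [eps] turns [8 / (eps ^+ 2 * l)] into [32 * (l + 4 * L ^+ 2) ^+ 2 / (mu ^+ 2 * l
     ^+ 3)]. *)
  by rewrite /eps; field; rewrite !gt_eqF.
- have N1 : N = 1%N by apply/eqP; rewrite eqn_leq N_le1.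
  have [A A0 Ab] := single_node_decay N1.
  have l0 := second_smallest_eigenvalue_single N1 hl.
  (* The separate rate [r] matters here: the prescribed exponent is zero, whereas [mu] still makes
     the transient vanish at infinity. *)
  exists A, mu; split => //; first by rewrite l0 mulr0 mul0r ltW.
  move=> t Tt i; have := Ab t Tt i; rewrite mulNr => /le_trans; apply.
  by rewrite l0 expr0n invr0 !mulr0 addr0.
Qed.

End Tail.

(** * Maxima and upper limits *)

Lemma limsup_pinfty_le (R : realType) (g : R -> R) (x T : R) :
  (forall t, T < t -> g t <= x) -> (limsup_pinfty g <= x%:E)%E.
Proof.
move=> gx; apply: (@le_trans _ _ (ereal_sup [set (g t)%:E | t in `]T, +oo[])).
  by apply: ereal_inf_lbound; exists T.
apply: ge_ereal_sup => y [t /=]; rewrite in_itv /= andbT => Tt <-.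
by rewrite lee_fin gx.
Qed.

Lemma limsup_pinfty_lt (R : realType) (g : R -> R) (x : R) :
  (limsup_pinfty g < x%:E)%E -> exists T, forall t, T < t -> g t <= x.
Proof.
move=> /ereal_inf_lt[_ [T _ <-] Tx]; exists T => t Tt; rewrite -lee_fin.
apply: le_trans (ltW Tx); apply: ereal_sup_ubound; exists t => //=.
by rewrite in_itv /= Tt.
Qed.

(** The index [i0] keeps the minimum below a real number, so it is finite and [fine] does not return
    its default 0. *)
Lemma bigmin_fine_pos (R : realType) (I : finType) (M : I -> R) (i0 : I) :
  (forall i, 0 < M i) ->
  0 < fine (\big[Order.min/+oo%E]_i (M i)%:E) /\
  forall i, fine (\big[Order.min/+oo%E]_i (M i)%:E) <= M i.
Proof.
move=> M0; set X := \big[_/_]_i _.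
have X_le i : (X <= (M i)%:E)%E by exact: bigmin_le.
have X_gt : (0 < X)%E by apply: lt_bigmin => // i _; rewrite lte_fin.
have X_fin : X \is a fin_num.
  rewrite ge0_fin_numE; last exact: ltW.
  exact: le_lt_trans (X_le i0) (ltry _).
split; first by rewrite -lte_fin fineK.
by move=> i; rewrite -lee_fin fineK.
Qed.

(** The threshold [A / (r * d)] comes from [expR x >= 1 + x]. *)
Lemma expR_vanishes (R : realType) (A r d : R) : 0 < r -> 0 < d -> 0 <= A ->
  exists T, forall t, T < t -> A * expR (- (r * t)) <= d.
Proof.
move=> r0 d0 A0; exists (A / (r * d)) => t; rewrite ltr_pdivrMr ?mulr_gt0 // => At.
rewrite expRN ler_pdivrMr ?expR_gt0 //.
have := ler_wpM2l (ltW d0) (expR_ge1Dx (r * t)); lra.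
Qed.

(** The extreme value theorem bounds each square, and the sum of the absolute bounds serves all
    indices at once. *)
Lemma bounded_on_initial_segment (R : realType) (I : finType) (g : I -> R -> R) (T : R) :
  0 <= T -> (forall i, {within `[0, +oo[, continuous (g i)}) ->
  exists2 b, 0 <= b & forall i t, 0 <= t <= T -> g i t ^+ 2 <= b.
Proof.
move=> T0 gc.
have /choice[b bP] : forall i, exists b, forall t, 0 <= t <= T -> g i t ^+ 2 <= b.
  move=> i; have g2 : {within `[0, T], continuous (fun t => g i t * g i t)}.
    have gi : {within `[0, T], continuous (g i)}.
      apply: continuous_subspaceW (gc i) => t /=; rewrite !in_itv /= andbT.
      by case/andP.
    by move=> t; apply: continuousM; exact: gi.
  have [c _ cP] := EVT_max T0 g2.
  by exists (g i c * g i c) => t t01; rewrite expr2 cP // in_itv.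
exists (\sum_i `|b i|); first by apply: sumr_ge0.
move=> i t t01; apply: (@le_trans _ _ `|b i|).
  by rewrite (le_trans (bP i t t01)) // ler_norm.
by rewrite (bigD1 i) //= lerDl sumr_ge0.
Qed.

(** * Both claims from the estimate on a tail *)

Unset Implicit Arguments.
Set Strict Implicit.

Theorem theorem5p1 (R : realType) (N : nat)
  (adj : rel 'I_N) (B : 'I_N -> 'I_N -> R) (M : 'I_N -> R)
  (f xi theta omega : 'I_N -> R -> R) (omega_b : R -> R)
  (mu L lambda2 : R)
  (* connected undirected (simple) graph with symmetric positive weights *)
  (adj_sym : forall i j, adj i j = adj j i)
  (adj_irr : forall i, ~~ adj i i)
  (adj_conn : forall i j, connect adj i j)
  (B_sym : forall i j, B i j = B j i)
  (B_pos : forall i j, adj i j -> 0 < B i j)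
  (M_pos : forall i, 0 < M i)
  (* lambda2 = second-smallest eigenvalue of M^{-1} L_B *)
  (hlambda2 : second_smallest_eigenvalue (invM_laplacian M adj B) lambda2)
  (* the f_i *)
  (f0 : forall i, f i 0 = 0)
  (f_der : forall i w, derivable (f i) w 1)
  (f_C1 : forall i, continuous (derive1 (f i)))
  (mu_pos : 0 < mu) (L_pos : 0 < L)
  (f_bnd : forall i w, - L <= (derive1 (f i)) w / M i <= - mu)
  (* disturbances: C^1 on (0, oo), finite right limit at 0 *)
  (xi_der : forall i t, 0 < t -> derivable (xi i) t 1)
  (xi_C1 : forall i, {in `]0, +oo[, continuous (derive1 (xi i))})
  (xi_jump : forall i, exists l : R, xi i x @[x --> 0^'+] --> l)
  (* (theta, omega) solves the nodal dynamics for t > 0 *)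
  (theta_cont : forall i, {within `[0, +oo[, continuous (theta i)})
  (omega_cont : forall i, {within `[0, +oo[, continuous (omega i)})
  (theta_ode : forall i t, 0 < t ->
     derivable (theta i) t 1 /\ (derive1 (theta i)) t = omega i t)
  (omega_ode : forall i t, 0 < t ->
     derivable (omega i) t 1 /\
     M i * (derive1 (omega i)) t =
       f i (omega i t) + xi i t - \sum_(j | adj i j) B i j * (theta i t - theta j t))
  (* omega_b solves the blended dynamics *)
  (omegab_cont : {within `[0, +oo[, continuous omega_b})
  (omegab_ode : forall t, 0 < t ->
     derivable omega_b t 1 /\
     (\sum_i M i) / N%:R * derive1 omega_b t =
       (\sum_i f i (omega_b t)) / N%:R + (\sum_i xi i t) / N%:R)
  (omegab_init : omega_b 0 = (\sum_i M i * omega i 0) / (\sum_i M i)) :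
  let M_b := (\sum_i M i) / N%:R in
  let M_min := fine (\big[Order.min/+oo%E]_i (M i)%:E) in
  let K := 32 * N%:R * M_b * (1 + L / mu) ^+ 2 / (M_min * mu ^+ 2) in
  let c := mu * lambda2 / (4 * (lambda2 + 4 * L ^+ 2)) in
  let Ce := \big[Order.max/-oo%E]_i
              ereal_sup [set (`|(derive1 (xi i)) t| / M i)%:E | t in `]0, +oo[] in
  let Climsup := \big[Order.max/-oo%E]_i
              limsup_pinfty (fun t => `|derive1 (xi i) t| / M i) in
  let gap := (lambda2 + 4 * L ^+ 2) ^+ 2 / lambda2 ^+ 3 in
  (Ce \is a fin_num ->
     exists alpha : R, 0 < alpha /\
       forall t : R, 0 < t ->
         \big[Num.max/0]_i (omega i t - omega_b t) ^+ 2
           <= alpha * expR (- (c * t)) + K * (fine Ce) ^+ 2 * gap) /\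
  (Climsup \is a fin_num ->
     (\big[Order.max/-oo%E]_i
        limsup_pinfty (fun t => ((omega i t - omega_b t) ^+ 2)%R)
      <= ((K * (fine Climsup) ^+ 2 * gap)%R)%:E)%E).
Proof.
move=> M_b M_min K c Ce Climsup gap.
(* Without nodes the maxima [Ce] and [Climsup] are [-oo], which is not finite, so both claims hold
   vacuously. *)
have [N0|N_gt0] := posnP N.
  by subst N; rewrite /Ce /Climsup !big_ord0; split.
have [Mm0 MmM] := bigmin_fine_pos (Ordinal N_gt0) M_pos; rewrite -/M_min in Mm0 MmM.
have NMb : N%:R * M_b = \sum_i M i.
  by rewrite /M_b mulrC divfK // pnatr_eq0 -lt0n.
have KE : K = 32 * (\sum_i M i) * (1 + L / mu) ^+ 2 / (M_min * mu ^+ 2).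
  by rewrite -NMb /K mulrA.
have tail (T C : R) : 0 < T ->
    (forall i t, T <= t -> `|derive1 (xi i) t| / M i <= C) ->
    exists A r, [/\ 0 <= A, 0 < r, c <= r & forall t, T <= t -> forall i,
      (omega i t - omega_b t) ^+ 2 <= A * expR (- (r * t)) + K * C ^+ 2 * gap].
  move=> T0 xiC; rewrite KE.
  exact: (tail_error N_gt0 adj_sym adj_irr adj_conn B_sym B_pos M_pos f_der
    mu_pos f_bnd xi_der theta_ode omega_ode omegab_ode T0 xiC hlambda2 Mm0 MmM).
have KG0 : 0 <= K * gap.
  have l0 := second_smallest_eigenvalue_ge0 adj_sym adj_irr adj_conn B_sym B_pos
    M_pos N_gt0 hlambda2.
  have M0 : 0 <= \sum_i M i by apply: sumr_ge0 => i _; exact: ltW.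
  apply: mulr_ge0; last by apply: divr_ge0; [exact: sqr_ge0|exact: exprn_ge0].
  rewrite KE; apply: divr_ge0; apply: mulr_ge0; rewrite ?sqr_ge0 ?(ltW Mm0) //.
  by rewrite mulr_ge0.
split=> [Cfin|Cfin].
  have xiC i (t : R) : 0 < t -> `|derive1 (xi i) t| / M i <= fine Ce.
    move=> t0; rewrite -lee_fin fineK //.
    apply: le_trans (le_bigmax _ _ i); apply: ereal_sup_ubound.
    by exists t => //=; rewrite in_itv /= t0.
  (* [xi] need not be differentiable at [0]: the energy argument starts at [t = 1],
     and [0, 1] is absorbed in [alpha]. *)
  have [|A [r [A0 r0 cr Ab]]] := tail 1 (fine Ce) ltr01.
    by move=> i t t1; apply: xiC; exact: lt_le_trans t1.
  have [|b b0 bP] := @bounded_on_initial_segment R 'I_N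
    (fun i t => omega i t - omega_b t) 1 ler01.
    by move=> i t; apply: continuousB; [exact: omega_cont|exact: omegab_cont].
  have KG0' : 0 <= K * fine Ce ^+ 2 * gap by rewrite mulrAC mulr_ge0 ?sqr_ge0.
  (* [A] serves [t >= 1], and the last summand serves [t <= 1], where the factor [expR (- (c * t))]
     is at least [expR (- |c|)]; the 1 makes the constant positive. *)
  exists (A + 1 + b * expR `|c|); split.
    by rewrite ltr_wpDr ?mulr_ge0 ?expR_ge0 // ltr_wpDl.
  move=> t t0; have be : 0 <= b * expR `|c| by rewrite mulr_ge0 ?expR_ge0.
  apply: bigmax_le => [|i _].
    by rewrite addr_ge0 // mulr_ge0 ?expR_ge0 // addr_ge0 // addr_ge0.
  have [t1|/ltW t1] := leP 1 t.
    apply: le_trans (Ab t t1 i) _; rewrite lerD2r.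
    apply: (@le_trans _ _ (A * expR (- (c * t)))).
      by rewrite ler_wpM2l // ler_expR lerN2 ler_wpM2r // ltW.
    by rewrite ler_wpM2r ?expR_ge0 // -addrA lerDl addr_ge0.
  apply: le_trans (bP i t _) _; first by rewrite t1 ltW.
  apply: (@le_trans _ _ (b * expR `|c| * expR (- (c * t)))).
    rewrite -mulrA ler_peMr // -expRD -[leLHS]expR0 ler_expR subr_ge0.
    by rewrite (le_trans (ler_norm _)) // normrM ler_piMr // gtr0_norm.
  apply: le_trans (_ : _ <= (A + 1 + b * expR `|c|) * expR (- (c * t))) _.
    by rewrite ler_wpM2r ?expR_ge0 // lerDr addr_ge0.
  by rewrite lerDl.
set Cl := fine Climsup; have ClE : Climsup = Cl%:E by rewrite fineK.
apply/lee_addgt0Pr => e e0.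
(* With [d <= 1], replacing [Cl] by [Cl + d] raises its square by at most [d * (2 * |Cl| + 1)].
   Together with a transient of size at most [d], the total excess is [d * D], hence at most [e]. *)
pose D := K * gap * (2 * `|Cl| + 1) + 1.
have D0 : 0 < D by rewrite ltr_wpDl // mulr_ge0 // addr_ge0 // mulr_ge0.
pose d := Num.min 1 (e / D).
have d0 : 0 < d by rewrite lt_min ltr01 divr_gt0.
have d1 : d <= 1 by rewrite ge_min lexx.
have dD : d * D <= e by rewrite -ler_pdivlMr // ge_min lexx orbT.
have /choice[T TP] : forall i, exists T, forall t, T < t ->
    `|derive1 (xi i) t| / M i <= Cl + d.
  move=> i; apply: limsup_pinfty_lt.
  apply: (@le_lt_trans _ _ Climsup); first exact: (le_bigmax _ _ i).
  by rewrite ClE lte_fin ltrDl.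
(* A positive time beyond every threshold [T i]. *)
pose T0 := 1 + \sum_i `|T i|.
have T00 : 0 < T0 by rewrite ltr_pwDl // sumr_ge0.
have [|A [r [A0 r0 _ Ab]]] := tail T0 (Cl + d) T00.
  move=> i t Tt; apply: TP; apply: lt_le_trans Tt.
  rewrite /T0 (bigD1 i) //= ltr_pwDl // ler_wpDr ?sumr_ge0 // ler_norm.
  by [].
have [T1 T1P] := expR_vanishes r0 d0 A0.
apply: bigmax_le => [|i _]; first by rewrite leNye.
rewrite -EFinD; apply: (@limsup_pinfty_le _ _ _ (Num.max T0 T1)) => t.
rewrite gt_max => /andP[/ltW tT0 tT1].
apply: le_trans (Ab t tT0 i) _.
have h1 := T1P t tT1.
have h2 : (Cl + d) ^+ 2 <= Cl ^+ 2 + d * (2 * `|Cl| + 1).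
  have := ler_wpM2l (ltW d0) (ler_norm Cl).
  have := ler_wpM2l (ltW d0) d1; lra.
have := ler_wpM2l KG0 h2; rewrite /D in dD; lra.
Qed.
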